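(* Let $I=(t_0,t_f)$ be a bounded open interval, $x_0\in\mathbb{R}^{n_x}$, $\mathbf{f}:I\times\mathbb{R}^{n_x}\times\mathbb{R}^{n_g}\to\mathbb{R}^{n_x}$, $\ell:I\times\mathbb{R}^{n_x}\times\mathbb{R}^{n_g}\to\mathbb{R}$, $\phi:\mathbb{R}^{n_x}\to\mathbb{R}$. Assume: (a) $\mathbf{f}(t,x,g)$ is measurable in $t$ for each $(x,g)$, continuous in $(x,g)$ for a.a. $t\in I$, and there is $m_f\in L^\infty(I)$ with $\|\mathbf{f}(t,x,g)\|\le m_f(t)(1+\|g\|)$ for a.a. $t\in I$ and all $x,g$; there is an integrable $l_f:I\to\mathbb{R}$ with $\|\mathbf{f}(t,x_1,g_1)-\mathbf{f}(t,x_2,g_2)\|\le l_f(t)(\|x_1-x_2\|+\|g_1-g_2\|)$ for a.a. $t\in I$ and all $x_1,x_2,g_1,g_2$. (b) Both $\boldsymbol{\varphi}=\mathbf{f}$ and $\boldsymbol{\varphi}=\ell$ satisfy condition (N) of the context; $t\mapsto\ell(t,0,0)$ is integrable on $I$; and $\phi$ is continuously differentiable. (c) $\mathbf{g}_*,\mathbf{g}_c,\mathbf{g}_+\in\mathcal{G}^2$, and there are constants $c_i\ge0$ and functions $\boldsymbol{\epsilon}_i(\cdot\,;Y_+,G_c):I\times\mathbb{R}^{n_x}\to[0,\infty)$, $i=1,\dots,n_g$, such that $$\big|(\mathbf{g}_+)_i(y)-(\mathbf{g}_* )_i(y)\big|\le c_i\,\boldsymbol{\epsilon}_i(y;Y_+,G_c)\qquad\text{for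 all }y\in I\times\mathbb{R}^{n_x},\ i=1,\dots,n_g.$$ Let $\mathbf{x}_c=\mathbf{x}(\cdot\,;\mathbf{g}_c)$, $\mathbf{y}_c(t)=(t,\mathbf{x}_c(t))$, assume that $t\mapsto\boldsymbol{\epsilon}_i(\mathbf{y}_c(t);Y_+,G_c)$ is measurable for each $i$, and let $\boldsymbol{\lambda}_c\in(W^{1,\infty}(I))^{n_x}$ be the solution of $$-\boldsymbol{\lambda}_c'(t)=\mathbf{A}_c[t]^T\boldsymbol{\lambda}_c(t)+\nabla_x\ell_c[t]+(\mathbf{g}_c)_x(t,\mathbf{x}_c(t))^T\nabla_g\ell_c[t]\ \text{ for a.a. }t\in I,\qquad \boldsymbol{\lambda}_c(t_f)=\nabla\phi(\mathbf{x}_c(t_f)).$$ Define $$V^{\rm QoI}(\mathbf{y}_c;Y_+,G_c)=\int_{t_0}^{t_f}\big|\mathbf{B}_c[t]^T\boldsymbol{\lambda}_c(t)+\nabla_g\ell_c[t]\big|^T\boldsymbol{\epsilon}(\mathbf{y}_c(t);Y_+,G_c)\,dt\in[0,\infty],$$ where the absolute value is applied componentwise and $\boldsymbol{\epsilon}=(\boldsymbol{\epsilon}_1,\dots,\boldsymbol{\epsilon}_{n_g})^T$. Then, with $c=\max\{c_1,\dots,c_{n_g}\}$ (and the convention $0\cdot\infty=0$), $$\big|\widetilde q_{\mathbf{g}}(\mathbf{g}_c)(\mathbf{g}_+-\mathbf{g}_* )\big|\le c\,V^{\rm QoI}(\mathbf{y}_c;Y_+,G_c).$$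
   Context: $\mathcal{G}^2$ is the normed space of all $\mathbf{g}:I\times\mathbb{R}^{n_x}\to\mathbb{R}^{n_g}$ such that $\mathbf{g}(t,x)$ is twice continuously partially differentiable in $x$ for a.a. $t\in I$, measurable in $t$ for each $x$, and $\|\mathbf{g}\|_{\mathcal{G}^2}=\sum_{n=0}^2\operatorname{ess\,sup}_{t\in I}\sup_{x\in\mathbb{R}^{n_x}}\|\partial_x^n\mathbf{g}(t,x)\|<\infty$. Condition (N) for a function $\boldsymbol{\varphi}:I\times\mathbb{R}^{n_x}\times\mathbb{R}^{n_g}\to\mathbb{R}^{n_\varphi}$: $\boldsymbol{\varphi}(t,x,g)$ is measurable in $t$ for all $(x,g)$ and continuously partially differentiable with respect to $x$ and $g$ for a.a. $t\in I$; there is $K$ with $\|\boldsymbol{\varphi}_x(t,0,0)\|\le K$ and $\|\boldsymbol{\varphi}_g(t,0,0)\|\le K$ for a.a. $t\in I$; and for all $R>0$ there is $L(R)$ with $\|\boldsymbol{\varphi}_x(t,x_1,g_1)-\boldsymbol{\varphi}_x(t,x_2,g_2)\|+\|\boldsymbol{\varphi}_g(t,x_1,g_1)-\boldsymbol{\varphi}_g(t,x_2,g_2)\|\le L(R)(\|x_1-x_2\|+\|g_1-g_2\|)$ for a.a. $t\in I$ and all $x_1,x_2,g_1,g_2$ in the closed balls of radius $R$ around $0$. For $\mathbf{g}\in\mathcal{G}^2$, $\mathbf{x}(\cdot\,;\mathbf{g})\in(W^{1,\infty}(I))^{n_x}$ is the unique solution (it exists under assumption (a)) of $\mathbf{x}'(t)=\mathbf{f}(t,\mathbf{x}(t),\mathbf{g}(t,\mathbf{x}(t)))$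 for a.a. $t\in I$, $\mathbf{x}(t_0)=x_0$. The quantity of interest is $$\widetilde q(\mathbf{g})=\phi(\mathbf{x}(t_f;\mathbf{g}))+\int_{t_0}^{t_f}\ell\big(t,\mathbf{x}(t;\mathbf{g}),\mathbf{g}(t,\mathbf{x}(t;\mathbf{g}))\big)\,dt,$$ and $\widetilde q_{\mathbf{g}}(\mathbf{g}_c)$ is the Fréchet derivative of $\widetilde q:\mathcal{G}^2\to\mathbb{R}$ at $\mathbf{g}_c$ (it exists under assumptions (a) and (b)), so $\widetilde q_{\mathbf{g}}(\mathbf{g}_c)\delta\mathbf{g}$ is its value in direction $\delta\mathbf{g}$. Shorthand, with everything evaluated along $\mathbf{x}_c$ with model $\mathbf{g}_c$: $(\mathbf{f}_c)_x[t]=\mathbf{f}_x(t,\mathbf{x}_c(t),\mathbf{g}_c(t,\mathbf{x}_c(t)))$, similarly $(\mathbf{f}_c)_g[t]$, $\nabla_x\ell_c[t]$, $\nabla_g\ell_c[t]$ (partial derivatives/gradients with respect to the arguments $x$ and $g$); $\mathbf{A}_c[t]=(\mathbf{f}_c)_x[t]+(\mathbf{f}_c)_g[t]\,(\mathbf{g}_c)_x(t,\mathbf{x}_c(t))$ and $\mathbf{B}_c[t]=(\mathbf{f}_c)_g[t]$. Interpretation: $\mathbf{g}_*$ is the true component function; $\mathbf{g}_c$ is the current surrogate built from data $(Y_c,G_c)$, with points $Y_c=[y_1,\dots,y_N]$ and values $G_c=[\mathbf{g}_*(y_1),\dots,\mathbf{g}_*(y_N)]$; $\mathbf{g}_+=\mathbf{g}_+[y_+]$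 is the refined surrogate built after adding the point $y_+$ and the value $\mathbf{g}_*(y_+)$, with $Y_+=[y_1,\dots,y_N,y_+]$. The symbols $Y_+,G_c$ in $\boldsymbol{\epsilon}_i$ only indicate which data the error bound may depend on. *)

(* Defs.v *)
From HB Require Import structures.
From mathcomp Require Import all_boot all_order all_algebra.
From mathcomp Require Import all_classical all_reals all_analysis ess_sup_inf.

Set Implicit Arguments.
Unset Strict Implicit.
Unset Printing Implicit Defensive.
Import Order.TTheory GRing.Theory Num.Theory.
Import numFieldNormedType.Exports.

Local Open Scope classical_set_scope.
Local Open Scope ring_scope.

(* Functions on I = ]t0, tf[ are represented by total functions on R; nothing
   depends on their values outside I (outside [t0, tf] for W1oo functions).
   Norms of vectors and matrices are the max norms of the library; the notions
   below only depend on them up to equivalence. *)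

(* R with the sigma-algebra of all Lebesgue measurable sets; the canonical
   measurable structure of R only contains the Borel sets. *)
Notation lebR R := (caratheodory_type ((wlength (@idfun R))^*)%mu).

Definition leb (R : realType) : {measure set (lebR R) -> \bar R} :=
  @completed_lebesgue_measure R.

Definition itv_oo (R : realType) (t0 tf : R) : set (lebR R) :=
  [set` `]t0, tf[].

Section differentiation.
Context {R : realType}.

Definition jac (n m : nat) (h : 'cV[R]_n -> 'cV[R]_m) (x : 'cV[R]_n) :
    'M[R]_(m, n) :=
  \matrix_(i, j) ('d h x (delta_mx j 0) : 'cV[R]_m) i 0.

(* All second order partial derivatives: the Jacobian of the vectorized
   Jacobian, with entries indexed by ((i, j), k). *)
Definition jac2 (n m : nat) (h : 'cV[R]_n -> 'cV[R]_m) (x : 'cV[R]_n) :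
    'M[R]_(m * n, n) :=
  jac (fun y => (mxvec (jac h y))^T) x.

Definition grad (n : nat) (h : 'cV[R]_n -> R) (x : 'cV[R]_n) : 'cV[R]_n :=
  (jac (fun y => (h y)%:M : 'cV[R]_1) x)^T.

Definition C1 (n m : nat) (h : 'cV[R]_n -> 'cV[R]_m) : Prop :=
  (forall x, differentiable h x) /\ continuous (jac h).

Definition C2 (n m : nat) (h : 'cV[R]_n -> 'cV[R]_m) : Prop :=
  C1 h /\ C1 (fun y => (mxvec (jac h y))^T).

End differentiation.

Section function_spaces.
Context {R : realType} (t0 tf : R).
Local Notation I := (itv_oo t0 tf).
Local Notation mu := (leb R).

Definition measurable_vec (n : nat) (u : R -> 'cV[R]_n) : Prop :=
  forall i, measurable_fun I (fun t : lebR R => u t i 0).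

Definition Linfty (u : R -> R) : Prop :=
  measurable_fun I (u : lebR R -> R) /\
  exists M : R, \forall t \ae mu, I t -> `|u t| <= M.

(* C^1 functions with compact support in ]t0, tf[ *)
Definition test_function (psi : R -> R) : Prop :=
  [/\ forall t, derivable psi t 1,
      continuous (derive1 psi) &
      exists a b : R, [/\ t0 < a, b < tf &
        forall t, ~ (a <= t <= b) -> psi t = 0]].

Definition weak_derivative (u w : R -> R) : Prop :=
  forall psi : R -> R, test_function psi ->
    \int[mu]_(t in I) (u t * derive1 psi t) = - \int[mu]_(t in I) (w t * psi t).

(* u is (the continuous representative on [t0, tf] of) an element of
   W^{1,oo}(I)^n, and its weak derivative is w. *)
Definition W1oo_derivative (n : nat) (u w : R -> 'cV[R]_n) : Prop :=
  {within `[t0, tf], continuous u} /\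
  forall i, [/\ Linfty (fun t => u t i 0), Linfty (fun t => w t i 0) &
                weak_derivative (fun t => u t i 0) (fun t => w t i 0)].

End function_spaces.

Section G2_space.
Context {R : realType} (t0 tf : R) {nx ng : nat}.
Local Notation I := (itv_oo t0 tf).
Local Notation mu := (leb R).
Local Notation model := (R -> 'cV[R]_nx -> 'cV[R]_ng).

(* The function of t is nonnegative, so extending it by 0 outside I does not
   change its essential supremum over I. *)
Definition ess_sup_sup (m n : nat) (h : R -> 'cV[R]_nx -> 'M[R]_(m, n)) :
    \bar R :=
  ess_sup mu
    ((fun t : lebR R => ereal_sup [set `|h t x|%:E | x in [set: 'cV[R]_nx]])
       \_ I).

Definition G2_enorm (g : model) : \bar R :=
  (ess_sup_sup g + ess_sup_sup (fun t => jac (g t))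
     + ess_sup_sup (fun t => jac2 (g t)))%E.

Definition G2_norm (g : model) : R := fine (G2_enorm g).

Definition G2 (g : model) : Prop :=
  [/\ \forall t \ae mu, I t -> C2 (g t),
      forall x, measurable_vec t0 tf (fun t => g t x) &
      (G2_enorm g < +oo)%E].

(* G2_norm is a norm on G2 up to equality for almost all t in I. Only the
   values of D on G2 matter, and they are uniquely determined. *)
Definition is_frechet_derivative (q : model -> R) (g : model)
    (D : model -> R) : Prop :=
  [/\ forall (a : R) (d1 d2 : model), G2 d1 -> G2 d2 ->
        D (a *: d1 + d2) = a * D d1 + D d2,
      exists C : R, forall d : model, G2 d -> `|D d| <= C * G2_norm d &
      forall e : R, 0 < e -> exists2 r : R, 0 < r &
        forall d : model, G2 d -> G2_norm d <= r ->
          `|q (g + d) - q g - D d| <= e * G2_norm d].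

End G2_space.

Section dynamics.
Context {R : realType} (t0 tf : R) {nx ng : nat}.
Local Notation I := (itv_oo t0 tf).
Local Notation mu := (leb R).
Local Notation model := (R -> 'cV[R]_nx -> 'cV[R]_ng).

Definition partial_x (n : nat) (phi : R -> 'cV[R]_nx -> 'cV[R]_ng -> 'cV[R]_n)
    (t : R) (x : 'cV[R]_nx) (g : 'cV[R]_ng) : 'M[R]_(n, nx) :=
  jac (fun y => phi t y g) x.

Definition partial_g (n : nat) (phi : R -> 'cV[R]_nx -> 'cV[R]_ng -> 'cV[R]_n)
    (t : R) (x : 'cV[R]_nx) (g : 'cV[R]_ng) : 'M[R]_(n, ng) :=
  jac (fun y => phi t x y) g.

Definition cond_N (n : nat) (phi : R -> 'cV[R]_nx -> 'cV[R]_ng -> 'cV[R]_n) :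
    Prop :=
  [/\ forall x g, measurable_vec t0 tf (fun t => phi t x g),
      \forall t \ae mu, I t ->
        [/\ forall x g, differentiable (fun y => phi t y g) x,
            forall x g, differentiable (fun y => phi t x y) g,
            continuous (fun p : 'cV[R]_nx * 'cV[R]_ng =>
                          partial_x phi t p.1 p.2) &
            continuous (fun p : 'cV[R]_nx * 'cV[R]_ng =>
                          partial_g phi t p.1 p.2)],
      exists K : R, \forall t \ae mu, I t ->
        `|partial_x phi t 0 0| <= K /\ `|partial_g phi t 0 0| <= K &
      forall r : R, 0 < r -> exists L : R, \forall t \ae mu, I t ->
        forall (x1 x2 : 'cV[R]_nx) (g1 g2 : 'cV[R]_ng),
          `|x1| <= r -> `|x2| <= r -> `|g1| <= r -> `|g2| <= r ->
          `|partial_x phi t x1 g1 - partial_x phi t x2 g2|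
            + `|partial_g phi t x1 g1 - partial_g phi t x2 g2|
          <= L * (`|x1 - x2| + `|g1 - g2|)].

Definition is_state (f : R -> 'cV[R]_nx -> 'cV[R]_ng -> 'cV[R]_nx)
    (x0 : 'cV[R]_nx) (g : model) (x : R -> 'cV[R]_nx) : Prop :=
  (exists2 w, W1oo_derivative t0 tf x w &
     \forall t \ae mu, I t -> w t = f t (x t) (g t (x t))) /\
  x t0 = x0.

(* The solution is unique on [t0, tf]; the choice matters only outside. *)
Definition state (f : R -> 'cV[R]_nx -> 'cV[R]_ng -> 'cV[R]_nx)
    (x0 : 'cV[R]_nx) (g : model) : R -> 'cV[R]_nx :=
  xget (cst 0) [set x | is_state f x0 g x].

Definition qoi (f : R -> 'cV[R]_nx -> 'cV[R]_ng -> 'cV[R]_nx)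
    (l : R -> 'cV[R]_nx -> 'cV[R]_ng -> R) (phi : 'cV[R]_nx -> R)
    (x0 : 'cV[R]_nx) (g : model) : R :=
  let x := state f x0 g in
  phi (x tf) + \int[mu]_(t in I) l t (x t) (g t (x t)).

Section along.
Variables (f : R -> 'cV[R]_nx -> 'cV[R]_ng -> 'cV[R]_nx)
  (l : R -> 'cV[R]_nx -> 'cV[R]_ng -> R) (g : model) (x : R -> 'cV[R]_nx).

Definition A_along (t : R) : 'M[R]_nx :=
  partial_x f t (x t) (g t (x t))
    + partial_g f t (x t) (g t (x t)) *m jac (g t) (x t).

Definition B_along (t : R) : 'M[R]_(nx, ng) :=
  partial_g f t (x t) (g t (x t)).

Definition gradx_along (t : R) : 'cV[R]_nx :=
  grad (fun y => l t y (g t (x t))) (x t).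

Definition gradg_along (t : R) : 'cV[R]_ng :=
  grad (fun y => l t (x t) y) (g t (x t)).

Definition is_adjoint (phi : 'cV[R]_nx -> R) (lambda : R -> 'cV[R]_nx) : Prop :=
  (exists2 w, W1oo_derivative t0 tf lambda w &
     \forall t \ae mu, I t ->
       - w t = (A_along t)^T *m lambda t + gradx_along t
                 + (jac (g t) (x t))^T *m gradg_along t) /\
  lambda tf = grad phi (x tf).

Definition V_QoI (lambda : R -> 'cV[R]_nx)
    (eps : R -> 'cV[R]_nx -> 'cV[R]_ng) : \bar R :=
  (\int[mu]_(t in I)
    (((map_mx Num.norm ((B_along t)^T *m lambda t + gradg_along t))^T
        *m eps t (x t)) 0 0)%:E)%E.

End along.

End dynamics.

(* Main.v *)
(* Since d |-> d(t, x_c(t)) is linear, the derivative can be guessed from the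
   adjoint: with W = B_c^T lambda_c + grad_g l_c it must be
   Dq(d) = int_I W(t) . d(t, x_c(t)) dt.  Let x solve the state equation for
   g_c + d and let z = x - x_c.  Gronwall's inequality gives |z| <= C |d|, and
   integrating (lambda_c . z)' over I turns grad phi . z(tf) into an integral in
   which, by the adjoint equation, all terms linear in z cancel.  What remains
   of q(g_c + d) - q(g_c) - Dq(d) are Taylor remainders of second order in |d|,
   plus the o(|z(tf)|) of phi.  The bound is then |W . d| <= c |W|^T eps under the
   integral.

   Existence of states is Picard iteration: since f is bounded along bounded
   models, the iterates stay in a fixed ball, where the local Lipschitz
   constants of condition (N) apply.  The weak formulation of W^{1,oo} is
   reduced to increments u(t) - u(s) = int_s^t w by du Bois-Reymond's lemma. *)

(* Fréchet differentiability asks for a remainder that is uniform in the direction [d], so every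
   constant is fixed before [d]. Directions have norm at most 1; then one ball contains both states
   and all model values along them, and one pair of constants from condition (N) serves for all [d].
   The norm of [G2] enters through its derivatives: [d(t,x) - d(t,x_c)] is at most a multiple of the
   norm of [d] times [|x - x_c|], hence of second order, and the bound on the second derivatives of
   [g_c] makes its Taylor remainder quadratic. A sup norm alone would give neither. All functions
   are merely measurable in [t], so every composition with a curve, and every Jacobian entry along
   it, needs its own measurability argument; exceptional null sets are harmless because the measure
   is complete. [V_QoI] may be infinite. The integrand of the derivative is bounded, since the
   weight and the models are, and is compared with [V_QoI] through extended integrals only. *)
Require Import Defs.
From HB Require Import structures.
From mathcomp Require Import all_boot all_order all_algebra.
From mathcomp Require Import all_classical all_reals all_analysis ess_sup_inf.
From mathcomp Require Import measurable_realfun lra ring.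

Set Implicit Arguments.
Unset Strict Implicit.
Unset Printing Implicit Defensive.
Import Order.TTheory GRing.Theory Num.Theory.
Import numFieldNormedType.Exports.

Local Open Scope classical_set_scope.
Local Open Scope ring_scope.

(** * Lebesgue measure on open intervals and measurability up to null sets *)

Section lebesgue_interval.
Context {R : realType}.
Implicit Types (a b : R).

Lemma borel_lebR (A : set R) : measurable A -> measurable (A : set (lebR R)).
Proof. exact: (@sub_caratheodory _ _ _ (wlength idfun)). Qed.

Lemma leb_lebesgue (A : set R) : leb R A = lebesgue_measure A.
Proof. reflexivity. Qed.

Lemma measurable_itv_oo a b : measurable (itv_oo a b).
Proof. by apply: borel_lebR; exact: measurable_itv. Qed.

Lemma leb_itv_oo a b : a <= b -> leb R (itv_oo a b) = (b - a)%:E.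
Proof.
rewrite leb_lebesgue lebesgue_measure_itv/= lte_fin -EFinB le_eqVlt.
by case/predU1P => [->|->//]; rewrite ltxx subrr.
Qed.

Lemma leb_itv_oo_lty a b : (leb R (itv_oo a b) < +oo)%E.
Proof.
rewrite leb_lebesgue lebesgue_measure_itv/= -EFinB.
by case: ifP => _; rewrite ltry.
Qed.

Lemma leb_setT_gt0 : (0 < leb R [set: lebR R])%E.
Proof.
have := lebesgue_measure_itv `]-oo, +oo[%R :> (_ = _ :> \bar R).
by rewrite set_itvE /= leb_lebesgue => ->; rewrite ?ltNyy /= ?ltry.
Qed.

Lemma leb_set1 a : leb R [set a] = 0%E.
Proof. by rewrite leb_lebesgue lebesgue_measure_set1. Qed.

Lemma measurable_lebR_set1 a : measurable ([set a] : set (lebR R)).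
Proof. by apply: borel_lebR; exact: measurable_set1. Qed.

Lemma borel_measurable_fun (D : set R) (f : R -> R) :
  measurable_fun D f -> measurable D ->
  measurable_fun (D : set (lebR R)) (f : lebR R -> R).
Proof. by move=> mf mD _ B mB; apply: borel_lebR; exact: mf. Qed.

Lemma itv_ooE a b t : itv_oo a b t = (a < t < b) :> Prop.
Proof. by rewrite /itv_oo /= in_itv. Qed.

Lemma itv_oo_split a b c : a < c -> c < b ->
  itv_oo a b `\` [set c] = itv_oo a c `|` itv_oo c b.
Proof.
move=> ac cb; apply/seteqP; split => x /=; rewrite !itv_ooE.
  move=> [/andP[ax xb] /eqP]; rewrite neq_lt => /orP[xc|cx].
    by left; rewrite ax.
  by right; rewrite cx.
move=> [/andP[ax xc]|/andP[cx xb]].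
  by rewrite ax (lt_trans xc cb); split => // xE; rewrite xE ltxx in xc.
by rewrite xb (lt_trans ac cx); split => // xE; rewrite xE ltxx in cx.
Qed.

(* This uses that leb is complete; it fails for the Borel sigma-algebra. *)
Lemma measurable_fun_ae_eq (D : set (lebR R)) (f g : lebR R -> R) :
  (\forall t \ae leb R, D t -> f t = g t) ->
  measurable_fun D f -> measurable_fun D g.
Proof.
move=> fg /measurable_EFinP mf; apply/measurable_EFinP.
apply: (@ae_measurable_fun _ _ _ (leb R) _ D (EFin \o f)) => //.
  exact: completed_lebesgue_measure_is_complete.
by apply: filterS fg => t fg Dt /=; rewrite fg.
Qed.

(** Setting all functions to 0 on a null set that contains the exceptional points makes the
    convergence hold everywhere on [D]; completeness undoes the modification. *)
Lemma measurable_fun_ae_cvg (D : set (lebR R)) (f : nat -> lebR R -> R)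
    (g : lebR R -> R) :
  (\forall t \ae leb R, D t -> f ^~ t @ \oo --> g t) ->
  (forall n, measurable_fun D (f n)) -> measurable_fun D g.
Proof.
move=> [N [mN N0 fg]] mf mD.
pose f' n := f n \_ (~` N); pose g' := g \_ (~` N).
have ae0 (h : lebR R -> R) : \forall t \ae leb R, D t -> h t = (h \_ (~` N)) t.
  exists N; split => // t /=; apply: contra_notP => Nt Dt.
  by rewrite patchE ifT// inE.
apply: (@measurable_fun_ae_eq D g' g) => //.
  by apply: filterS (ae0 g) => t + Dt => /(_ Dt) ->.
apply: (@measurable_fun_cvg _ _ _ D f' g') => //.
  by move=> n; apply: (measurable_fun_ae_eq (ae0 (f n))).
move=> t Dt; rewrite /f' /g'; have [tN|tN] := boolP (t \in ~` N).
  rewrite (_ : (fun n => _) = f ^~ t).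
    rewrite patchE tN; move: tN; rewrite inE /= => tN.
    by apply: contrapT => h; apply/tN/fg => /= /(_ Dt).
  by apply/funext => n; rewrite patchE tN.
rewrite (_ : (fun n => _) = fun=> 0); last first.
  by apply/funext => n; rewrite patchE (negbTE tN).
by rewrite patchE (negbTE tN); exact: cvg_cst.
Qed.

End lebesgue_interval.

(** * The max norm of matrices *)

Section matrix_norm.
Context {R : realFieldType}.

Lemma mx_norm_entry m n (A : 'M[R]_(m, n)) i j : `|A i j| <= `|A|.
Proof.
by rewrite {2}/Num.norm/= mx_normrE; apply: (le_bigmax _ (fun ij =>
  `|A ij.1 ij.2|) (i, j)).
Qed.

Lemma mx_norm_leP m n (A : 'M[R]_(m, n)) (r : R) : 0 <= r ->
  (forall i j, `|A i j| <= r) -> `|A| <= r.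
Proof.
by move=> r0 Ar; rewrite /Num.norm/= mx_normrE; apply/bigmax_leP; split.
Qed.

Lemma cV_norm_leP n (x : 'cV[R]_n) (r : R) : 0 <= r ->
  (forall i, `|x i 0| <= r) -> `|x| <= r.
Proof. by move=> r0 xr; apply: mx_norm_leP => // i j; rewrite ord1. Qed.

(** The max norm is not submultiplicative: an entry of the product is a sum of [n] terms. The
    dimension factors in the later constants come from here. *)
Lemma mx_norm_mul m n p (A : 'M[R]_(m, n)) (B : 'M[R]_(n, p)) :
  `|A *m B| <= n%:R * `|A| * `|B|.
Proof.
apply: mx_norm_leP => [|i j]; first by rewrite !mulr_ge0.
rewrite mxE (le_trans (ler_norm_sum _ _ _))//.
rewrite (@le_trans _ _ (\sum_(k < n) `|A| * `|B|))//.
  by apply: ler_sum => k _; rewrite normrM ler_pM// mx_norm_entry.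
by rewrite sumr_const card_ord -mulrA mulr_natl.
Qed.

Lemma mx_norm_tr m n (A : 'M[R]_(m, n)) : `|A^T| = `|A|.
Proof.
apply/eqP; rewrite eq_le; apply/andP; split; apply: mx_norm_leP => // i j.
  by rewrite mxE mx_norm_entry.
by rewrite -(trmxK A) mxE trmxK mx_norm_entry.
Qed.

End matrix_norm.

(** * Measurability of compositions with Caratheodory functions *)

Section caratheodory_composition.
Context {R : realType}.

(* The map u is rounded down to a grid of mesh 1 / k; then t |-> h t (u t) is
   measurable because u takes countably many values, and k tends to infinity. *)
Lemma caratheodory_comp n (D : set (lebR R)) (h : R -> 'cV[R]_n -> R)
    (u : R -> 'cV[R]_n) :
  (forall x, measurable_fun D (fun t : lebR R => h t x)) ->
  (\forall t \ae leb R, D t -> {for u t, continuous (h t)}) ->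
  (forall i, measurable_fun D (fun t : lebR R => u t i 0)) ->
  measurable_fun D (fun t : lebR R => h t (u t)).
Proof.
move=> mh ch mu.
pose fl k (t : lebR R) : 'cV[int]_n := \col_i Num.floor (u t i 0 * k.+1%:R).
pose v k (z : 'cV[int]_n) : 'cV[R]_n := \col_i ((z i 0)%:~R / k.+1%:R).
apply: (@measurable_fun_ae_cvg _ D (fun k t => h t (v k (fl k t)))).
  apply: filterS ch => t ch Dt.
  apply: (@cvg_comp _ _ _ (fun k => v k (fl k t)) (h t) \oo (nbhs (u t))).
    apply/cvgrPdist_le => e e0; near=> k.
    apply: cV_norm_leP => [|i]; first exact: ltW.
    rewrite !mxE; have /andP[lo hi] := floor_itv (u t i 0 * k.+1%:R).
    have k0 : 0 < k.+1%:R :> R by [].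
    rewrite -[X in `|X - _|](mulfK (lt0r_neq0 k0)) -mulrBl normrM normfV.
    rewrite (gtr0_norm k0) ler_pdivrMr//.
    have e1 : 1 <= e * k.+1%:R.
      rewrite -ler_pdivrMr// div1r ltW//.
      by near: k; exact: (near_infty_natSinv_lt (PosNum e0)).
    apply: le_trans e1; rewrite ler_norml; move: lo hi; rewrite intrD.
    lra.
  exact: ch.
move=> k mD B mB.
pose E z := [set t | D t /\ fl k t = z].
have -> : D `&` (fun t => h t (v k (fl k t))) @^-1` B =
  \bigcup_z (E z `&` (D `&` (fun t => h t (v k z)) @^-1` B)).
  apply/seteqP; split => t /=.
    by move=> [Dt Bt]; exists (fl k t).
  by move=> [z _ [[Dt <-]] [_ Bt]].
apply: countable_bigcupT_measurable => // z.
apply: measurableI; last exact: mh.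
(* Rounding down to [z] is one half-open interval condition per coordinate. *)
have -> : E z = D `&` \bigcap_i (D `&` (fun t : lebR R => u t i 0) @^-1`
    [set` `[(z i 0)%:~R / k.+1%:R, (z i 0 + 1)%:~R / k.+1%:R[ ]).
  apply/seteqP; split => t /=.
    move=> [Dt <-]; split => // i _; split => //=; rewrite in_itv/= mxE.
    by rewrite ler_pdivrMr// ltr_pdivlMr// floor_itv.
  move=> [Dt H]; split => //; apply/colP => i; rewrite mxE.
  have [_ /=] := H i I; rewrite in_itv/= ler_pdivrMr// ltr_pdivlMr// => zi.
  exact: floor_def.
apply: measurableI => //; apply: fin_bigcap_measurable => // i _.
by apply: mu => //; exact: measurable_itv.
Unshelve. all: by end_near. Qed.

End caratheodory_composition.

(** * Integrals over open intervals and essentially bounded functions *)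

Section interval_integral.
Context {R : realType}.
Local Notation mu := (leb R).
Implicit Types (a b c M : R) (h k : R -> R).

Definition intg a b h := mu.-integrable (itv_oo a b) (fun t => (h t)%:E).
(** The integral is not oriented: for [b <= a] the interval is empty and the value is 0. Hence the
    order hypotheses in the additivity rules. *)
Definition Int a b h : R := \int[mu]_(t in itv_oo a b) h t.

Lemma intgS a b c d h : a <= c -> d <= b -> intg a b h -> intg c d h.
Proof.
move=> ac db; apply: integrableS; try exact: measurable_itv_oo.
move=> t; rewrite !itv_ooE => /andP[ct td].
by rewrite (le_lt_trans ac ct) (lt_le_trans td db).
Qed.

Lemma intg_measurable a b h :
  intg a b h -> measurable_fun (itv_oo a b) (h : lebR R -> R).
Proof. by move=> /measurable_int/measurable_EFinP. Qed.

Lemma intgD a b h k : intg a b h -> intg a b k -> intg a b (h \+ k).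
Proof.
move=> ih ik; rewrite /intg; under eq_fun do rewrite EFinD.
by apply: integrableD => //; exact: measurable_itv_oo.
Qed.

Lemma intgN a b h : intg a b h -> intg a b (\- h).
Proof.
move=> ih; rewrite /intg; under eq_fun do rewrite EFinN.
exact: integrableN.
Qed.

Lemma intgB a b h k : intg a b h -> intg a b k -> intg a b (h \- k).
Proof. by move=> ih ik; apply: intgD => //; exact: intgN. Qed.

Lemma IntD a b h k : intg a b h -> intg a b k ->
  Int a b (h \+ k) = Int a b h + Int a b k.
Proof. by move=> ih ik; apply: RintegralD => //; exact: measurable_itv_oo. Qed.

Lemma IntB a b h k : intg a b h -> intg a b k ->
  Int a b (h \- k) = Int a b h - Int a b k.
Proof. by move=> ih ik; apply: RintegralB => //; exact: measurable_itv_oo. Qed.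

Lemma IntZ a b r h : intg a b h -> Int a b (r \*o h) = r * Int a b h.
Proof. by move=> ih; apply: RintegralZl => //; exact: measurable_itv_oo. Qed.

Lemma Int_cst a b r : a <= b -> Int a b (cst r) = r * (b - a).
Proof.
move=> ab; rewrite /Int Rintegral_cst ?leb_itv_oo//.
exact: measurable_itv_oo.
Qed.

(** Completeness of the measure transfers measurability from [h] to [k]. *)
Lemma Int_ae_eq a b h k : intg a b h ->
  (\forall t \ae mu, itv_oo a b t -> h t = k t) -> Int a b h = Int a b k.
Proof.
move=> ih hk; rewrite /Int /Rintegral; congr fine.
have mh := intg_measurable ih.
apply: ae_eq_integral.
- exact: measurable_itv_oo.
- exact/measurable_EFinP.
- by apply/measurable_EFinP; exact: measurable_fun_ae_eq hk mh.
- by apply: filterS hk => t hk Dt; rewrite hk.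
Qed.

Lemma Int_ge0 a b h : intg a b h ->
  (\forall t \ae mu, itv_oo a b t -> 0 <= h t) -> 0 <= Int a b h.
Proof.
(* Replacing [h] by its absolute value, almost everywhere the same function, turns the sign
   condition into a pointwise one. *)
move=> ih h0; rewrite (@Int_ae_eq _ _ _ (Num.norm \o h))//.
  by apply: Rintegral_ge0 => t _ /=.
by apply: filterS h0 => t h0 /h0 h0t /=; rewrite ger0_norm.
Qed.

Lemma Int_le a b h k : intg a b h -> intg a b k ->
  (\forall t \ae mu, itv_oo a b t -> h t <= k t) -> Int a b h <= Int a b k.
Proof.
move=> ih ik hk; rewrite -subr_ge0 -IntB//; apply: Int_ge0; first exact: intgB.
by apply: filterS hk => t hk /hk /=; rewrite subr_ge0.
Qed.

Lemma Int_norm a b h : intg a b h ->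
  `|Int a b h| <= Int a b (Num.norm \o h).
Proof. by move=> ih; apply: le_normr_Rintegral => //;
  exact: measurable_itv_oo. Qed.

Lemma intg_norm a b h : intg a b h -> intg a b (Num.norm \o h).
Proof. by move=> ih; apply: integrable_norm. Qed.

Lemma Int_norm_le a b h k : intg a b h -> intg a b k ->
  (\forall t \ae mu, itv_oo a b t -> `|h t| <= k t) ->
    `|Int a b h| <= Int a b k.
Proof.
move=> ih ik hk; rewrite (le_trans (Int_norm ih))// Int_le//.
exact: intg_norm.
Qed.

Lemma Int_diag a h : Int a a h = 0.
Proof.
rewrite /Int (_ : itv_oo a a = set0) ?Rintegral_set0//.
apply/seteqP; split => // t; rewrite itv_ooE.
by case/andP => /lt_trans /[apply]; rewrite ltxx.
Qed.

Lemma Int_split a b c h : a <= c -> c <= b -> intg a b h ->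
  Int a b h = Int a c h + Int c b h.
Proof.
move=> ac cb ih.
move: ac; rewrite le_eqVlt => /predU1P[->|ac]; first by rewrite Int_diag add0r.
move: cb; rewrite le_eqVlt => /predU1P[<-|cb]; first by rewrite Int_diag addr0.
(* Two open intervals miss the splitting point, which is removed first as a null set. *)
have -> : Int a b h = \int[mu]_(t in itv_oo a b `\` [set c]) h t.
  rewrite /Int /Rintegral; congr fine; apply: negligible_integral => //.
  - exact: measurable_lebR_set1.
  - exact: measurable_itv_oo.
  - exact: leb_set1.
rewrite itv_oo_split// Rintegral_setU//.
- exact: measurable_itv_oo.
- exact: measurable_itv_oo.
- apply: integrableS ih; first exact: measurable_itv_oo.
    by apply: measurableU; exact: measurable_itv_oo.
  by rewrite -itv_oo_split//; exact: subDsetl.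
- apply/disj_setPS => t [/=]; rewrite !itv_ooE => /andP[_ tc] /andP[ct _].
  by move: (lt_trans tc ct); rewrite ltxx.
Qed.

Lemma Linfty_intg a b h : Linfty a b h -> intg a b h.
Proof.
move=> [mh [M hM]]; apply/integrableP; split; first exact/measurable_EFinP.
rewrite (@le_lt_trans _ _ (`|M|%:E * mu (itv_oo a b))%E)//; last first.
  by rewrite lte_mul_pinfty// leb_itv_oo_lty.
apply: integral_le_bound; [exact: measurable_itv_oo|exact/measurable_EFinP| |].
  by rewrite lee_fin.
apply: filterS hM => t hM /hM ht /=; rewrite lee_fin.
by rewrite (le_trans ht)// ler_norm.
Qed.

Lemma intg_dominated a b h k : measurable_fun (itv_oo a b) (h : lebR R -> R) ->
  intg a b k -> (\forall t \ae mu, itv_oo a b t -> `|h t| <= k t) -> intg a b h.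
Proof.
move=> mh /integrableP[mk ik] hk; apply/integrableP.
split; first exact/measurable_EFinP.
apply: le_lt_trans ik; apply: ae_ge0_le_integral.
- exact: measurable_itv_oo.
- by move=> t _; exact: abse_ge0.
- by apply: measurableT_comp; [exact: abse_measurable|exact/measurable_EFinP].
- by move=> t _; exact: abse_ge0.
- by apply: measurableT_comp; [exact: abse_measurable|exact: mk].
- by apply: filterS hk => t hk /hk ht; rewrite lee_fin (le_trans ht (ler_norm
  _)).
Qed.

Lemma LinftyS a b c d h : a <= c -> d <= b -> Linfty a b h -> Linfty c d h.
Proof.
move=> ac db [mh [M hM]].
have sub : itv_oo c d `<=` itv_oo a b.
  move=> t; rewrite !itv_ooE => /andP[ct td].
  by rewrite (le_lt_trans ac ct) (lt_le_trans td db).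
split; first exact: measurable_funS (measurable_itv_oo _ _) sub mh.
by exists M; apply: filterS hM => t + /sub; apply.
Qed.

Lemma Linfty_ae_eq a b h k : Linfty a b h ->
  (\forall t \ae mu, itv_oo a b t -> h t = k t) -> Linfty a b k.
Proof.
move=> [mh [M hM]] hk; split; first exact: measurable_fun_ae_eq hk mh.
by exists M; apply: filterS2 hM hk => t hM hk Dt; rewrite -hk// hM.
Qed.

Lemma Linfty_cst a b r : Linfty a b (cst r).
Proof. by split => //; exists `|r|; apply: aeW. Qed.

Lemma LinftyD a b h k : Linfty a b h -> Linfty a b k -> Linfty a b (h \+ k).
Proof.
move=> [mh [M hM]] [mk [N kN]]; split; first exact: measurable_funD.
exists (M + N); apply: filterS2 hM kN => t hM kN Dt /=.
by rewrite (le_trans (ler_normD _ _))// lerD ?hM ?kN.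
Qed.

Lemma LinftyM a b h k : Linfty a b h -> Linfty a b k -> Linfty a b (h \* k).
Proof.
move=> [mh [M hM]] [mk [N kN]]; split; first exact: measurable_funM.
exists (M * N); apply: filterS2 hM kN => t hM kN Dt /=.
by rewrite normrM ler_pM ?hM ?kN.
Qed.

Lemma LinftyN a b h : Linfty a b h -> Linfty a b (\- h).
Proof.
move=> [mh [M hM]]; split; first exact: measurableT_comp.
by exists M; apply: filterS hM => t hM Dt /=; rewrite normrN hM.
Qed.

Lemma LinftyB a b h k : Linfty a b h -> Linfty a b k -> Linfty a b (h \- k).
Proof. by move=> lh /LinftyN; exact: LinftyD. Qed.

Lemma Linfty_sum a b n (h : 'I_n -> R -> R) :
  (forall i, Linfty a b (h i)) -> Linfty a b (fun t => \sum_i h i t).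
Proof.
move=> lh; rewrite (_ : (fun t => _) = \sum_i h i); last first.
  by apply/funext => t; rewrite fct_sumE.
elim/big_ind: _ => //; [exact: (Linfty_cst a b 0)|].
by move=> ? ?; exact: LinftyD.
Qed.

Lemma Int_bound a b M h : a <= b -> Linfty a b h ->
  (\forall t \ae mu, itv_oo a b t -> `|h t| <= M) -> `|Int a b h| <= M * (b -
    a).
Proof.
move=> ab lh hM; rewrite -Int_cst//; apply: Int_norm_le => //.
  exact: Linfty_intg.
exact/Linfty_intg/Linfty_cst.
Qed.

Lemma Int_sum a b n (h : 'I_n -> R -> R) : (forall i, Linfty a b (h i)) ->
  Int a b (fun t => \sum_i h i t) = \sum_i Int a b (h i).
Proof.
elim: n h => [|n IH] h lh.
  rewrite big_ord0 (_ : (fun t => _) = cst 0); last first.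
    by apply/funext => t; rewrite big_ord0.
  by rewrite /Int Rintegral_cst ?mul0r//; exact: measurable_itv_oo.
rewrite big_ord_recl -IH// -IntD; last 2 first.
- exact: Linfty_intg.
- exact/Linfty_intg/Linfty_sum.
by congr Int; apply/funext => t; rewrite big_ord_recl.
Qed.

Lemma continuous_Linfty a b h :
  {within `[a, b], continuous h} -> Linfty a b h.
Proof.
move=> ch; have [ab|ba] := leP a b; last first.
  have e : itv_oo a b = set0.
    apply/seteqP; split => // t; rewrite itv_ooE => /andP[/lt_trans /[apply]].
    by move=> /(lt_trans ba); rewrite ltxx.
  split; first by rewrite e; exact: measurable_fun_set0.
  by exists 0; apply: aeW => t; rewrite e.
split.
  apply: (@measurable_funS _ _ _ _ (`[a, b]%classic : set (lebR R))).
  - by apply: borel_lebR; exact: measurable_itv.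
  - by move=> t /=; rewrite itv_ooE in_itv/= => /andP[/ltW-> /ltW->].
  - apply: borel_measurable_fun; last exact: measurable_itv.
    by apply: subspace_continuous_measurable_fun => //; exact: measurable_itv.
have cn : {within `[a, b], continuous (fun t => `|h t|)}.
  by move=> t; apply: cvg_norm; exact: ch.
have [x _ xmax] := EVT_max ab cn.
exists `|h x|; apply: aeW => t; rewrite itv_ooE => /andP[ta tb].
by apply: xmax; rewrite in_itv/= !ltW.
Qed.

End interval_integral.

(** * Functions controlled by their increments *)

Section increments.
Context {R : realType}.
Local Notation mu := (leb R).
Implicit Types (a b c M r s t : R) (u v w y : R -> R).

Lemma within_itv_eps a b u t e : {within `[a, b], continuous u} ->
  a <= t <= b -> 0 < e -> exists2 d, 0 < d &
    forall s, a <= s <= b -> `|s - t| < d -> `|u s - u t| <= e.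
Proof.
move=> cu tab e0.
have abt : `[a, b]%classic t by rewrite /= in_itv.
have /cvgrPdist_le/(_ e e0) := proj1 (subspace_continuousP _ _) cu t abt.
rewrite /prop_near1 /= /within /=.
move=> [d /= d0 H]; exists d => // s sab st.
rewrite distrC; apply: (H s) => /=; first by rewrite distrC.
by rewrite in_itv.
Qed.

(** The clamp [cl] onto [[a, b]] is 1-Lipschitz, so [u \o cl] is continuous on the whole line, and
    it agrees with [u] on the interval. *)
Lemma lipschitz_within a b M u :
  (forall s t, a <= s -> s <= t -> t <= b -> `|u t - u s| <= M * (t - s)) ->
  {within `[a, b], continuous u}.
Proof.
move=> lu; have [ab|ba] := leP a b; last first.
  rewrite set_itv_ge ?bnd_simp -?ltNge// => t.
  by have := @continuous_subspace0 _ _ u; exact.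
pose cl t := Num.max a (Num.min t b).
have clab t : a <= cl t <= b.
  by rewrite /cl le_max lexx/= ge_max ab/= ge_min lexx orbT.
have cl_id t : a <= t <= b -> cl t = t.
  by move=> /andP[at_ tb]; rewrite /cl (min_idPl tb) (max_idPr at_).
apply: (@subspace_eq_continuous _ _ _ (u \o cl)).
  by move=> t; rewrite inE/= in_itv/= => /cl_id ->.
apply: continuous_subspaceT => t; apply/cvgrPdist_le => e e0.
(* [M] carries no sign; the enlarged constant is positive and can be divided by. *)
have M0 : 0 < `|M| + 1 by rewrite ltr_wpDl.
near=> s; rewrite /=.
have Hl : `|u (cl t) - u (cl s)| <= (`|M| + 1) * `|cl t - cl s|.
  have Hle x z : a <= x -> x <= z -> z <= b -> `|u z - u x| <= (`|M| + 1) * `|z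
    - x|.
    move=> ax xz zb; rewrite (le_trans (lu _ _ ax xz zb))//.
    have zx0 : 0 <= z - x by rewrite subr_ge0.
    by rewrite (ger0_norm zx0) ler_wpM2r// (le_trans (ler_norm M))// lerDl.
  have /andP[? ?] := clab s; have /andP[? ?] := clab t.
  have [st|/ltW ts] := leP (cl s) (cl t); first exact: Hle.
  by rewrite distrC [X in _ * X]distrC; exact: Hle.
have cl_lip : `|cl t - cl s| <= `|t - s|.
  have maxl x z : `|Num.max a x - Num.max a z| <= `|x - z|.
    have := ler_norm (x - z); have := ler_norm (z - x).
    rewrite distrC => ? ?; rewrite ler_norml.
    by have [?|?] := leP a x; have [?|?] := leP a z; lra.
  have minl x z : `|Num.min x b - Num.min z b| <= `|x - z|.
    have := ler_norm (x - z); have := ler_norm (z - x).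
    rewrite distrC => ? ?; rewrite ler_norml.
    by have [?|?] := leP x b; have [?|?] := leP z b; lra.
  exact: le_trans (maxl _ _) (minl _ _).
rewrite (le_trans Hl)// (@le_trans _ _ ((`|M| + 1) * `|t - s|))//.
  by rewrite ler_wpM2l// ltW.
rewrite -ler_pdivlMl// ltW//; near: s.
by apply: cvgr_dist_lt; [exact: cvg_id|rewrite mulrC divr_gt0].
Unshelve. all: by end_near. Qed.

(** Bisecting [k] times leaves [2 ^+ k] pieces, each with an increment of order [4 ^- k]; the sum is
    of order [2 ^- k]. This replaces the argument that the derivative vanishes and avoids
    differentiating integrals of merely bounded functions. *)
Lemma quadratic_increments_const a b M (G : R -> R) : a <= b ->
  (forall s t, a <= s -> s <= t -> t <= b -> `|G t - G s| <= M * (t - s) ^+ 2)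
    ->
  G b = G a.
Proof.
move=> ab Gq.
have key k s t : a <= s -> s <= t -> t <= b ->
    `|G t - G s| <= M * (t - s) ^+ 2 / 2 ^+ k.
  elim: k s t => [|k IH] s t as_ st tb; first by rewrite expr0 divr1 Gq.
  pose m := (s + t) / 2.
  have sm : s <= m by rewrite /m; lra.
  have mt : m <= t by rewrite /m; lra.
  have := IH s m as_ sm (le_trans mt tb).
  have := IH m t (le_trans as_ sm) mt tb.
  have -> : t - m = (t - s) / 2 by rewrite /m; field.
  have -> : m - s = (t - s) / 2 by rewrite /m; field.
  have e2k : 2 ^+ k != 0 :> R by rewrite expf_neq0.
  have -> : M * (t - s) ^+ 2 / 2 ^+ k.+1 =
    M * ((t - s) / 2) ^+ 2 / 2 ^+ k + M * ((t - s) / 2) ^+ 2 / 2 ^+ k.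
    by rewrite [2 ^+ k.+1]exprS; field.
  move=> H1 H2; have -> : G t - G s = (G t - G m) + (G m - G s) by ring.
  by rewrite (le_trans (ler_normD _ _))// lerD.
apply/eqP; rewrite -subr_eq0 -normr_le0; apply/ler_addgt0Pr => e e0.
rewrite add0r.
pose N := `|M * (b - a) ^+ 2| + 1.
have N0 : 0 < N by rewrite ltr_wpDl.
have eN : 0 < e / N by rewrite divr_gt0.
near \oo => k.
apply: (le_trans (key k a b (lexx a) ab (lexx b))).
have k2 : 0 < 2 ^+ k :> R by rewrite exprn_gt0.
rewrite ler_pdivrMr// (@le_trans _ _ N)//.
  by rewrite (le_trans (ler_norm _))// lerDl.
have : 1 / 2 ^+ k < e / N by near: k; exact: (near_infty_natSinv_expn_lt
  (PosNum eN)).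
by rewrite ltr_pdivrMr// mulrAC ltr_pdivlMr// mul1r => /ltW.
Unshelve. all: by end_near. Qed.

Lemma measurable_fun_idR :
  measurable_fun [set: lebR R] (idfun : lebR R -> measurableTypeR R).
Proof. by move=> _ B mB; rewrite setTI; exact: borel_lebR. Qed.

(** [leb] is pushed forward along the identity to the Borel structure, on which the fundamental
    theorem of calculus is stated. *)
Lemma Int_lebesgue a b w : continuous w ->
  Int a b w = \int[lebesgue_measure]_(t in `]a, b[) w t.
Proof.
move=> cw; rewrite /Int /Rintegral; congr fine.
have /Linfty_intg iw : Linfty a b w.
  by apply: continuous_Linfty; exact: continuous_subspaceT.
rewrite -[LHS](@integral_pushforward _ _ _ (measurableTypeR R) _ (idfun :
  lebR R -> measurableTypeR R)
  measurable_fun_idR (leb R) `]a, b[%classic (EFin \o w)) //.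
by apply/measurable_EFinP; apply: continuous_measurable_fun; exact: cw.
Qed.

End increments.

(** * Primitives of bounded functions *)

Section primitive.
Context {R : realType}.
Local Notation mu := (leb R).
Implicit Types (a b c M r s t : R) (u v w y : R -> R).

(** The integrated form of a bounded weak derivative. It speaks about the values at [a] and [b], as
    initial conditions and boundary terms require. *)
Definition primitive a b u w := Linfty a b w /\
  forall s t, a <= s -> s <= t -> t <= b -> u t - u s = Int s t w.

Lemma primitive_lip a b u w : primitive a b u w -> exists2 M, 0 <= M &
  forall s t, a <= s -> s <= t -> t <= b -> `|u t - u s| <= M * (t - s).
Proof.
move=> [lw uw]; have [mw [M wM]] := lw.
exists `|M| => // s t as_ st tb; rewrite uw//; apply: Int_bound => //.
  exact: LinftyS lw.
apply: filterS wM => z + zst; rewrite itv_ooE => wM.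
apply: (le_trans _ (ler_norm M)); apply: wM.
move: zst; rewrite itv_ooE => /andP[sz zt].
by rewrite (le_lt_trans as_ sz) (lt_le_trans zt tb).
Qed.

Lemma primitive_continuous a b u w : primitive a b u w ->
  {within `[a, b], continuous u}.
Proof. by move=> /primitive_lip[M _ uM]; exact: lipschitz_within uM. Qed.

Lemma primitive_Linfty a b u w : primitive a b u w -> Linfty a b u.
Proof. by move=> /primitive_continuous/continuous_Linfty. Qed.

Lemma primitive_Int a b r w : Linfty a b w ->
  primitive a b (fun t => r + Int a t w) w.
Proof.
move=> lw; split => // s t as_ st tb.
rewrite (@Int_split _ a t s)//; first by ring.
by apply: Linfty_intg; apply: LinftyS lw.
Qed.

Lemma primitiveD a b u v w y : primitive a b u w -> primitive a b v y ->
  primitive a b (u \+ v) (w \+ y).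
Proof.
move=> [lw uw] [ly vy]; split; first exact: LinftyD.
move=> s t as_ st tb; rewrite IntD.
- by rewrite -uw// -vy//=; ring.
- by apply: Linfty_intg; apply: LinftyS lw.
- by apply: Linfty_intg; apply: LinftyS ly.
Qed.

Lemma primitiveN a b u w : primitive a b u w -> primitive a b (\- u) (\- w).
Proof.
move=> [lw uw]; split; first exact: LinftyN.
move=> s t as_ st tb /=; rewrite -opprD uw//.
rewrite (_ : \- w = -1 \*o w) ?IntZ ?mulN1r//; first exact/Linfty_intg/(LinftyS
  _ _ lw).
by apply/funext => z /=; rewrite mulN1r.
Qed.

Lemma primitiveB a b u v w y : primitive a b u w -> primitive a b v y ->
  primitive a b (u \- v) (w \- y).
Proof. by move=> pu /primitiveN; exact: primitiveD. Qed.

Lemma primitive_sum a b n (u w : 'I_n -> R -> R) :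
  (forall i, primitive a b (u i) (w i)) ->
  primitive a b (fun t => \sum_i u i t) (fun t => \sum_i w i t).
Proof.
move=> uw; split; first by apply: Linfty_sum => i; have [] := uw i.
move=> s t as_ st tb; rewrite Int_sum => [|i]; last first.
  by have [lw _] := uw i; apply: LinftyS lw.
rewrite -sumrB; apply: eq_bigr => i _.
by have [_ ->] := uw i.
Qed.

Lemma C1_primitive a b (F f : R -> R) : (forall t, is_derive t 1 F (f t)) ->
  continuous f -> primitive a b F f.
Proof.
move=> Ff cf; split; first exact/continuous_Linfty/continuous_subspaceT.
move=> s t as_ st tb.
have cF : continuous F.
  by move=> x; apply: differentiable_continuous; apply/derivable1_diffP.
rewrite Int_lebesgue//; move: st; rewrite le_eqVlt => /predU1P[->|st].
  by rewrite set_itv_ge ?bnd_simp ?ltxx// Rintegral_set0 subrr.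
have cfs : {within `[s, t], continuous f} by exact: continuous_subspaceT.
have fE : F^`()%classic = f.
  by apply/funext => x; rewrite derive1E; exact: derive_val.
have -> : \int[lebesgue_measure]_(x in `]s, t[) f x =
    fine (\int[lebesgue_measure]_(x in `[s, t]) (f x)%:E).
  have mf (D : set R) : measurable_fun D (EFin \o f).
    apply/measurable_EFinP; apply: measurable_funTS.
    by apply: continuous_measurable_fun; exact: cf.
  rewrite /Rintegral (@integral_itv_bndo_bndc _ _ _ (EFin \o f)) ?mf//.
  by rewrite (@integral_itv_obnd_cbnd _ _ _ (EFin \o f)) ?mf//; exact: mf.
rewrite (@continuous_FTC2 _ f F)//=.
- split; first by move=> x _; exact: ex_derive.
  + by apply: cvg_at_right_filter; exact: cF.
  + by apply: cvg_at_left_filter; exact: cF.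
- by move=> x _; rewrite fE.
Qed.

(** The product rule without pointwise derivatives: the difference [G] of the product and the
    claimed integral has quadratic increments, because on a short interval each bounded factor meets
    an increment of a Lipschitz function. So [G] is constant. *)
Lemma primitiveM a b u v w y : a <= b ->
  primitive a b u w -> primitive a b v y ->
  primitive a b (u \* v) ((w \* v) \+ (u \* y)).
Proof.
move=> ab pu pv.
have [Mu Mu0 Hu] := primitive_lip pu; have [Mv Mv0 Hv] := primitive_lip pv.
have [lw uw] := pu; have [ly vy] := pv.
have lu := primitive_Linfty pu; have lv := primitive_Linfty pv.
have lz : Linfty a b ((w \* v) \+ (u \* y)).
  by apply: LinftyD; apply: LinftyM.
split => // s0 t0 as0 st0 tb0.
pose G t := u t * v t - Int s0 t ((w \* v) \+ (u \* y)).
suff : G t0 = G s0.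
  rewrite /G /= => H; have I0 : Int s0 s0 ((w \* v) \+ (u \* y)) = 0.
    have := @Int_split _ s0 t0 s0 ((w \* v) \+ (u \* y)) (lexx _) st0.
    move=> /(_ (Linfty_intg (LinftyS as0 tb0 lz))); lra.
  move: H; rewrite I0; lra.
have [_ [Nw Hw]] := lw; have [_ [Ny Hy]] := ly.
apply: (@quadratic_increments_const _ s0 t0 (`|Nw| * Mv + Mu * `|Ny|)) =>
  // s t s0s st tt0.
have as_ : a <= s by rewrite (le_trans as0).
have tb : t <= b by rewrite (le_trans tt0).
have L1 h : Linfty a b h -> Linfty s t h by apply: LinftyS.
(* [v] is frozen at the right end and [u] at the left end: [u t * v t - u s * v s = (u t - u s) * v
   t + u s * (v t - v s)]. *)
have -> : G t - G s = Int s t (fun z => w z * (v t - v z) + (u s - u z) * y z).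
  have -> : (fun z => w z * (v t - v z) + (u s - u z) * y z) =
     ((v t \*o w) \+ (u s \*o y)) \- ((w \* v) \+ (u \* y)).
    by apply/funext => z /=; ring.
  have i1 : Linfty s t (v t \*o w).
    by apply: LinftyM; [exact: Linfty_cst|exact: L1].
  have i2 : Linfty s t (u s \*o y).
    by apply: LinftyM; [exact: Linfty_cst|exact: L1].
  rewrite IntB; [|exact/Linfty_intg/LinftyD|exact/Linfty_intg/L1].
  rewrite IntD; [|exact: Linfty_intg|exact: Linfty_intg].
  rewrite !IntZ; [|exact/Linfty_intg/L1|exact/Linfty_intg/L1].
  rewrite -uw// -vy// /G (@Int_split _ s0 t s)//.
    by ring.
  by apply: Linfty_intg; apply: LinftyS lz.
rewrite expr2 mulrA; apply: Int_bound; first exact: st.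
  apply: LinftyD; apply: LinftyM; [exact: L1| | |exact: L1].
    by apply: LinftyB; [exact: Linfty_cst|exact: L1].
  by apply: LinftyB; [exact: Linfty_cst|exact: L1].
apply: filterS2 Hw Hy => z Hw Hy; rewrite itv_ooE => /andP[sz zt].
have zab : itv_oo a b z by rewrite itv_ooE (le_lt_trans as_ sz) (lt_le_trans zt
  tb).
have az : a <= z by rewrite (le_trans as_)// ltW.
have zb : z <= b by rewrite (le_trans _ tb)// ltW.
rewrite (le_trans (ler_normD _ _))// !normrM mulrDl -!mulrA lerD//.
  rewrite ler_pM//; first by rewrite (le_trans (Hw zab))// ler_norm.
  rewrite (le_trans (Hv _ _ az (ltW zt) tb))// ler_wpM2l//; lra.
rewrite mulrCA mulrC ler_pM//.
  by rewrite (le_trans (Hy zab))// ler_norm.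
rewrite distrC (le_trans (Hu _ _ as_ (ltW sz) zb))// ler_wpM2l//; lra.
Qed.

End primitive.

(** * Weak derivatives and the lemma of du Bois-Reymond *)

Section weak_derivative.
Context {R : realType}.
Local Notation mu := (leb R).
Implicit Types (a b c M r s t : R) (u v w : R -> R).

(** A quadratic remainder bound is an algebraic inequality, so the kink of [ppart] below needs no
    one-sided limits. *)
Lemma quadratic_is_derive (F : R -> R) t r M :
  (forall s, `|F s - F t - r * (s - t)| <= M * (s - t) ^+ 2) ->
    is_derive t 1 F r.
Proof.
move=> FM.
have cv : (fun h => h^-1 *: ((F \o shift t) (h *: (1 : R)) - F t)) @ 0^' --> r.
  apply/cvgrPdist_le => e e0; near=> h.
  have h0 : h != 0 by near: h; exact: nbhs_dnbhs_neq.
  have := FM (h + t); rewrite addrK => Fh.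
  rewrite /= [h *: 1]mulr1 [_ *: _]mulrC distrC.
  have -> : (F (h + t) - F t) / h - r = (F (h + t) - F t - r * h) / h by field.
  rewrite normrM normfV ler_pdivrMr ?normr_gt0// (le_trans Fh)//.
  rewrite -real_normK ?num_real// expr2 mulrA ler_wpM2r//.
  rewrite (@le_trans _ _ ((`|M| + 1) * `|h|))//.
    by rewrite ler_wpM2r// (le_trans (ler_norm M))// lerDl.
  have M0 : 0 < `|M| + 1 by rewrite ltr_wpDl.
  rewrite -ler_pdivlMl// ltW//; near: h; apply: dnbhs0_lt.
  by rewrite mulrC divr_gt0.
apply: DeriveDef; first by apply/cvg_ex; exists r.
exact: cvg_lim cv.
Unshelve. all: by end_near. Qed.

(** The positive part. Its square is the simplest C^1 function that vanishes on a half-line, and the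
    test functions are combinations of its translates. *)
Definition ppart t : R := Num.max 0 t.

Lemma is_derive_sqr_ppart c t :
  is_derive t 1 (fun t => ppart (t - c) ^+ 2) (2 * ppart (t - c)).
Proof.
apply: (@quadratic_is_derive _ _ _ 1) => s; rewrite mul1r /ppart ler_norml.
have -> : s - t = (s - c) - (t - c) by ring.
move: (s - c) (t - c) => B A; have AB2 := sqr_ge0 (B - A).
have A2 := sqr_ge0 A; have B2 := sqr_ge0 B.
have [A0|A0] := leP 0 A; have [B0|B0] := leP 0 B; apply/andP; split.
- lra.
- lra.
- by have := mulr_ge0_le0 A0 (ltW B0); lra.
- by have := mulr_ge0_le0 A0 (ltW B0); lra.
- lra.
- by have := mulr_le0_ge0 (ltW A0) B0; lra.
- lra.
- lra.
Qed.

(* hat e is a hat function with support [0, 2 * e] and integral 2 * e ^+ 2, and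
   spline e is its primitive. The difference of two translates of spline e is
   then a C^1 test function whose derivative tests two point values against each
   other. The term t - 0 makes the three summands instances of one pattern. *)
Definition spline e t := ppart (t - 0) ^+ 2 - 2 * ppart (t - e) ^+ 2 +
  ppart (t - 2 * e) ^+ 2.
Definition hat e t := 2 * (ppart (t - 0) - 2 * ppart (t - e) + ppart (t - 2 *
  e)).

Lemma is_derive_spline e c t :
  is_derive t 1 (fun t => spline e (t - c)) (hat e (t - c)).
Proof.
rewrite /spline /hat.
have E k : (fun t : R => ppart (t - c - k) ^+ 2) = fun t =>
  ppart (t - (c + k)) ^+ 2.
  by apply/funext => x; congr (ppart _ ^+ 2); ring.
have D k : is_derive t 1 (fun t : R => ppart (t - c - k) ^+ 2) (2 * ppart (t -
  c - k)).
  rewrite E (_ : t - c - k = t - (c + k)); last by ring.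
  exact: is_derive_sqr_ppart.
have D0 := D 0; have D1 := D e; have D2 := D (2 * e).
have DZ : is_derive t 1 (fun t : R => 2 * ppart (t - c - e) ^+ 2)
    (2 * (2 * ppart (t - c - e))) by exact: is_deriveZ.
apply: is_derive_eq; ring.
Qed.

Lemma continuous_ppart : continuous ppart.
Proof. by move=> t; apply: continuous_max; [exact: cvg_cst|exact: cvg_id]. Qed.

Lemma continuous_hat e c : continuous (fun t => hat e (t - c)).
Proof.
have C k : continuous (fun t : R => ppart (t - c - k)).
  move=> t; apply: (@continuous_comp _ _ _ (fun t => t - c - k) ppart).
    by apply: continuousB; [apply: continuousB|]; [exact: cvg_id| |];
      exact: cvg_cst.
  exact: continuous_ppart.
move=> t; rewrite /hat; apply: cvgMr.
by apply: cvgD; [apply: cvgB; [|apply: cvgMr]|]; exact: C.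
Qed.

Lemma hat_ge0 e t : 0 <= e -> 0 <= hat e t.
Proof.
move=> e0; rewrite /hat /ppart.
by have [?|?] := leP 0 (t - 0); have [?|?] := leP 0 (t - e);
  have [?|?] := leP 0 (t - 2 * e); lra.
Qed.

Lemma hat_out e t : 0 <= e -> ~ (0 <= t <= 2 * e) -> hat e t = 0.
Proof.
move=> e0; rewrite /hat /ppart => /negP; rewrite negb_and -!ltNge => /orP[?|?];
by have [?|?] := leP 0 (t - 0); have [?|?] := leP 0 (t - e);
  have [?|?] := leP 0 (t - 2 * e); lra.
Qed.

Lemma spline_le0 e t : 0 <= e -> t <= 0 -> spline e t = 0.
Proof.
move=> e0 t0; rewrite /spline /ppart.
by have [?|?] := leP 0 (t - 0); have [?|?] := leP 0 (t - e);
  have [?|?] := leP 0 (t - 2 * e); nra.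
Qed.

Lemma spline_ge e t : 0 <= e -> 2 * e <= t -> spline e t = 2 * e ^+ 2.
Proof.
move=> e0 t0; rewrite /spline /ppart.
have [?|?] := leP 0 (t - 0); last by lra.
have [?|?] := leP 0 (t - e); last by lra.
have [?|?] := leP 0 (t - 2 * e); last by lra.
ring.
Qed.

(** Left of [x] both splines vanish and right of [y + 2 * e] both equal [2 * e ^+ 2]; the difference
    therefore has compact support. *)
Lemma spline_test_function t0 tf e x y : 0 < e -> t0 < x -> x < y ->
  y + 2 * e < tf -> test_function t0 tf (fun t => spline e (t - x) - spline e
    (t - y)) /\
  derive1 (fun t => spline e (t - x) - spline e (t - y)) =
    fun t => hat e (t - x) - hat e (t - y).
Proof.
move=> e0 t0x xy ytf.
have dE : derive1 (fun t => spline e (t - x) - spline e (t - y)) =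
    fun t => hat e (t - x) - hat e (t - y).
  apply/funext => t; rewrite derive1E.
  have D1 := is_derive_spline e x t; have D2 := is_derive_spline e y t.
  exact: derive_val.
split => //; split.
- move=> t; have D1 := is_derive_spline e x t; have D2 :=
  is_derive_spline e y t.
  exact: ex_derive.
- by rewrite dE => t; apply: cvgB; exact: continuous_hat.
- exists x, (y + 2 * e); split => // t /negP; rewrite negb_and -!ltNge.
  move=> /orP[tx|yt].
    by rewrite !spline_le0 ?subrr//; lra.
  by rewrite !spline_ge ?subrr//; lra.
Qed.

(** Testing with a difference of splines equates the weighted integrals of [p] over a short interval
    after [x] and over one after [y]. By continuity these are close to [p x] and [p y] times the
    common mass of the hats. *)
Lemma weak_derivative0_const t0 tf (p : R -> R) : {within `[t0, tf], continuous
  p} ->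
  (forall psi, test_function t0 tf psi ->
    Int t0 tf (fun t => p t * derive1 psi t) = 0) ->
  forall x y, t0 < x -> x < y -> y < tf -> p x = p y.
Proof.
move=> cp p0 x y t0x xy ytf.
apply/eqP; rewrite -subr_eq0 -normr_le0; apply/ler_addgt0Pr => eta0 eta00.
rewrite add0r; pose eta := eta0 / 2; have eta_gt0 : 0 < eta by rewrite divr_gt0.
have xI : t0 <= x <= tf by rewrite !ltW// (lt_trans xy).
have yI : t0 <= y <= tf by rewrite !ltW// (lt_trans _ xy).
have [dx dx0 Hx] := within_itv_eps cp xI eta_gt0.
have [dy dy0 Hy] := within_itv_eps cp yI eta_gt0.
(* A hat is supported on an interval of length [2 * e]; the divisor 3 keeps it strictly inside both
   continuity neighbourhoods and below [tf]. *)
pose e := Num.min (Num.min dx dy) (tf - y) / 3.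
have e0 : 0 < e.
  by rewrite divr_gt0// !lt_min dx0 dy0 subr_gt0.
have e3 : 3 * e <= dx /\ 3 * e <= dy /\ 3 * e <= tf - y.
  have -> : 3 * e = Num.min (Num.min dx dy) (tf - y) by rewrite /e; field.
  by rewrite !ge_min !lexx !orbT.
case: e3 => ex [ey etf].
have lp : Linfty t0 tf p by exact: continuous_Linfty.
have lh z : Linfty t0 tf (fun t => hat e (t - z)).
  by apply/continuous_Linfty/continuous_subspaceT/continuous_hat.
have mass z : t0 < z -> z + 2 * e < tf -> Int t0 tf (fun t =>
  hat e (t - z)) = 2 * e ^+ 2.
  move=> t0z ztf.
  have [_ <-] := @C1_primitive R t0 tf _ _ (is_derive_spline e z)
    (@continuous_hat e z);
    [|exact: lexx|lra|exact: lexx].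
  by rewrite spline_ge ?spline_le0 ?subr0//; lra.
have bound z d : t0 < z -> z + 2 * e < tf -> 3 * e <= d ->
    (forall s, t0 <= s <= tf -> `|s - z| < d -> `|p s - p z| <= eta) ->
    `|Int t0 tf (fun t => p t * hat e (t - z)) - p z * (2 * e ^+ 2)| <=
      eta * (2 * e ^+ 2).
  move=> t0z ztf ed Hz.
  have l1 : Linfty t0 tf (fun t => p t * hat e (t - z)) by exact: LinftyM.
  have l2 r : Linfty t0 tf (fun t => r * hat e (t - z)).
    by apply: (@LinftyM _ _ _ (cst r)) => //; exact: Linfty_cst.
  rewrite -(mass z)// -!IntZ; [|exact: Linfty_intg (lh z)..].
  rewrite -IntB; [|exact: Linfty_intg l1|exact: Linfty_intg (l2 _)].
  apply: Int_norm_le; [|exact: Linfty_intg (l2 _)|].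
    exact: Linfty_intg (LinftyB l1 (l2 _)).
  apply: aeW => t; rewrite itv_ooE => /andP[t0t ttf] /=.
  rewrite -mulrBl normrM (ger0_norm (hat_ge0 _ (ltW e0))).
  have [H|/negP H] := boolP (0 <= t - z <= 2 * e); last first.
    by rewrite hat_out ?mulr0// ltW.
  rewrite ler_wpM2r ?hat_ge0 ?(ltW e0)//; apply: Hz; first by rewrite !ltW.
  by case/andP: H => ? ?; rewrite ger0_norm; lra.
have [T dE] := @spline_test_function t0 tf e x y e0 t0x xy ltac:(lra).
have := p0 _ T; rewrite dE.
rewrite (_ : (fun t => _) = (fun t => p t * hat e (t - x)) \-
  (fun t => p t * hat e (t - y))); last by apply/funext => t /=; rewrite mulrBr.
rewrite IntB; [|exact/Linfty_intg/LinftyM..].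
have Bx := bound x dx t0x ltac:(lra) ex Hx.
have By := bound y dy (lt_trans t0x xy) ltac:(lra) ey Hy.
move: Bx By; rewrite !ler_norml => /andP[? ?] /andP[? ?] ?.
have E0 : 0 < 2 * e ^+ 2 by rewrite mulr_gt0// exprn_gt0.
have etaE : eta0 = 2 * eta by rewrite /eta; field.
by apply/andP; split; rewrite -(ler_pM2r E0) etaE; lra.
Qed.

(** Integration by parts over the whole interval; the boundary terms vanish because [psi] is 0 at
    both ends. *)
Lemma primitive_weak_derivative t0 tf u w : t0 < tf -> primitive t0 tf u w ->
  weak_derivative t0 tf u w.
Proof.
move=> t0tf pu psi [dpsi cpsi [x [y [t0x ytf out]]]].
have ppsi : primitive t0 tf psi (derive1 psi).
  apply: C1_primitive => // t; rewrite derive1E; exact: derivableP.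
have lu := primitive_Linfty pu; have [lw _] := pu.
have lpsi := primitive_Linfty ppsi; have [lpsi' _] := ppsi.
have [_ /(_ t0 tf (lexx _) (ltW t0tf) (lexx _))] := primitiveM (ltW t0tf) pu
  ppsi.
rewrite /= !out ?mulr0 ?subrr; last 2 first.
- by move=> /andP[]; rewrite leNgt t0x.
- by move=> /andP[_]; rewrite leNgt ytf.
rewrite IntD; [|exact/Linfty_intg/LinftyM..].
by move=> /eqP; rewrite eq_sym addrC addr_eq0 => /eqP.
Qed.

(** The difference of [u] and the primitive of [w] has weak derivative 0, so it is constant inside
    the interval, and by continuity up to its ends. *)
Lemma weak_derivative_primitive t0 tf u w : t0 < tf ->
  {within `[t0, tf], continuous u} -> Linfty t0 tf w ->
  weak_derivative t0 tf u w -> primitive t0 tf u w.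
Proof.
move=> t0tf cu lw uw; split => //.
pose v t := 0 + Int t0 t w.
have pv : primitive t0 tf v w by exact: primitive_Int.
have cv := primitive_continuous pv.
have vw := primitive_weak_derivative t0tf pv.
pose p t := u t - v t.
have cp : {within `[t0, tf], continuous p}.
  by move=> t; apply: cvgB; [exact: cu|exact: cv].
have lu := continuous_Linfty cu; have lv := continuous_Linfty cv.
have p0 psi : test_function t0 tf psi -> Int t0 tf (fun t =>
  p t * derive1 psi t) = 0.
  move=> T; have lp : Linfty t0 tf (derive1 psi).
    by case: T => _ ? _; exact/continuous_Linfty/continuous_subspaceT.
  rewrite (_ : (fun t => _) = (u \* derive1 psi) \- (v \* derive1 psi));
    last first.
    by apply/funext => t; rewrite /p mulrBl.
  rewrite IntB; [|exact/Linfty_intg/LinftyM..].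
  by have := uw _ T; have := vw _ T; rewrite /Int => -> ->; rewrite subrr.
have pc := weak_derivative0_const cp p0.
pose m := (t0 + tf) / 2; have t0m : t0 < m by rewrite /m; lra.
have mtf : m < tf by rewrite /m; lra.
have pin s : t0 < s -> s < tf -> p s = p m.
  move=> t0s stf; have [sm|ms|->//] := ltgtP s m; first exact: pc.
  by apply/esym/pc.
have close z : t0 <= z <= tf -> (forall d, 0 < d -> exists2 s, t0 < s < tf &
  `|s - z| < d) ->
    p z = p m.
  move=> zI near; apply/eqP; rewrite -subr_eq0 -normr_le0;
    apply/ler_addgt0Pr => e e0.
  have [d d0 H] := within_itv_eps cp zI e0.
  have [s /andP[t0s stf] sz] := near d d0.
  by rewrite add0r -(pin s)// distrC H// !ltW.
have pE s : t0 <= s -> s <= tf -> p s = p m.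
  rewrite le_eqVlt => /predU1P[<- _|t0s].
    apply: close => [|d d0]; first by rewrite lexx ltW.
    (* The distance to the midpoint [m] caps the step so that the point stays inside the
       interval. *)
    exists (t0 + Num.min (d / 2) (m - t0)).
      rewrite ltrDl lt_min divr_gt0//= subr_gt0 t0m/=.
      by rewrite (@le_lt_trans _ _ m)// -lerBrDl ge_min lexx orbT.
    rewrite addrC addKr ger0_norm ?le_min ?divr_ge0 ?subr_ge0 ?ltW//.
    by rewrite gt_min; apply/orP; left; lra.
  rewrite le_eqVlt => /predU1P[->|stf]; last exact: pin.
  apply: close => [|d d0]; first by rewrite lexx ltW.
  have M0 : 0 < Num.min (d / 2) (tf - m) by rewrite lt_min divr_gt0//= subr_gt0.
  exists (tf - Num.min (d / 2) (tf - m)).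
    rewrite ltrBlDr ltrDl M0 andbT (@lt_le_trans _ _ m)//.
    by rewrite lerBrDr -lerBrDl ge_min lexx orbT.
  rewrite addrAC subrr sub0r normrN gtr0_norm//.
  by rewrite gt_min; apply/orP; left; lra.
move=> s t t0s st ttf.
have := pE s t0s (le_trans st ttf); have := pE t (le_trans t0s st) ttf.
have [_ <-//] := pv; rewrite /p; lra.
Qed.

End weak_derivative.

(** * Jacobians, mean value and Taylor estimates *)

Section matrix_calculus.
Context {R : realType}.

Lemma diff_jac n m (h : 'cV[R]_n -> 'cV[R]_m) x v :
  differentiable h x -> 'd h x v = jac h x *m v.
Proof.
move=> dh; apply/colP => i; rewrite mxE.
rewrite {1}[v]matrix_sum_delta (eq_bigr (fun j => v j 0 *: delta_mx j 0));
  last first.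
  by move=> j _; rewrite big_ord1.
rewrite linear_sum summxE; apply: eq_bigr => j _.
by rewrite linearZ !mxE mulrC.
Qed.

Lemma is_derive_line n m (h : 'cV[R]_n -> 'cV[R]_m) (y v : 'cV[R]_n) i (s : R) :
  differentiable h (y + s *: v) ->
  is_derive s 1 (fun s => h (y + s *: v) i 0) ((jac h (y + s *: v) *m v) i 0).
Proof.
move=> dh; set a := y + s *: v.
have cv : k^-1 *: ((h \o shift a) (k *: v) - h a) @[k --> 0^'] --> jac h a *m v.
  rewrite -diff_jac//.
  have := @diff_derivable _ _ _ h a v dh.
  by rewrite -deriveE//; exact.
have cvi : k^-1 *: ((fun s => h (y + s *: v) i 0) (k *: (1 : R) + s) - h a i 0)
    @[k --> 0^'] --> (jac h a *m v) i 0.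
  have -> : (fun k => k^-1 *: (h (y + (k *: (1 : R) + s) *: v) i 0 - h a i 0)) =
    (fun A : 'cV[R]_m => A i 0) \o
    (fun k => k^-1 *: ((h \o shift a) (k *: v) - h a)).
    apply/funext => k /=; rewrite !mxE; congr (_ * (h _ i 0 - _)).
    by rewrite /a [k *: 1]mulr1 scalerDl addrCA addrC.
  by apply: cvg_comp cv _; exact: coord_continuous.
apply: DeriveDef; first by apply/cvg_ex; exists ((jac h a *m v) i 0).
exact: cvg_lim cvi.
Qed.

(** The intermediate point depends on the coordinate [i]; the norm estimates below are therefore
    assembled coordinate by coordinate. *)
Lemma mean_value_cV n m (h : 'cV[R]_n -> 'cV[R]_m) (x y : 'cV[R]_n) i :
  (forall z, differentiable h z) ->
  exists2 s : R, 0 <= s <= 1 &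
    (h x - h y) i 0 = (jac h (y + s *: (x - y)) *m (x - y)) i 0.
Proof.
move=> dh.
have D s := is_derive_line i (dh (y + s *: (x - y))).
have cF : {within `[0, 1], continuous (fun s => h (y + s *: (x - y)) i 0)}.
  apply: continuous_subspaceT => s.
  by apply: differentiable_continuous; apply/derivable1_diffP; exact: ex_derive.
have [s] := MVT_segment ler01 (fun s _ => D s) cF.
rewrite in_itv/= => s01; rewrite scale1r scale0r addr0 subr0 mulr1 [y + (x -
  y)]addrC subrK.
by move=> E; exists s => //; rewrite -E !mxE.
Qed.

Lemma mean_value_le n m (h : 'cV[R]_n -> 'cV[R]_m) (x y : 'cV[R]_n) M :
  (forall z, differentiable h z) ->
  (forall s, 0 <= s <= 1 -> `|jac h (y + s *: (x - y))| <= M) ->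
  `|h x - h y| <= n%:R * M * `|x - y|.
Proof.
move=> dh hM.
have M0 : 0 <= M.
  by apply: le_trans (hM 0 _) => //; rewrite lexx ler01.
apply: cV_norm_leP => [|i]; first by rewrite !mulr_ge0.
have [s /hM sM ->] := mean_value_cV x y i dh.
rewrite (le_trans (mx_norm_entry _ _ _))// (le_trans (mx_norm_mul _ _))//.
by rewrite ler_wpM2r// ler_wpM2l.
Qed.

(** [A] is arbitrary rather than the Jacobian at [y]: in [smooth_taylor] it is a partial Jacobian
    taken at another value of the second argument. *)
Lemma taylor1_le n m (h : 'cV[R]_n -> 'cV[R]_m) (x y : 'cV[R]_n) A M :
  (forall z, differentiable h z) ->
  (forall s, 0 <= s <= 1 -> `|jac h (y + s *: (x - y)) - A| <= M) ->
  `|h x - h y - A *m (x - y)| <= n%:R * M * `|x - y|.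
Proof.
move=> dh hM.
have M0 : 0 <= M.
  by apply: le_trans (hM 0 _) => //; rewrite lexx ler01.
apply: cV_norm_leP => [|i]; first by rewrite !mulr_ge0.
have [s /hM sM E] := mean_value_cV x y i dh.
have -> : (h x - h y - A *m (x - y)) i 0 =
    ((jac h (y + s *: (x - y)) - A) *m (x - y)) i 0.
  by rewrite mulmxBl [LHS]mxE E [RHS]mxE [in RHS]mxE [in LHS]mxE.
rewrite (le_trans (mx_norm_entry _ _ _))// (le_trans (mx_norm_mul _ _))//.
by rewrite ler_wpM2r// ler_wpM2l.
Qed.

Lemma segment_norm_le n (x y : 'cV[R]_n) r s : 0 <= s <= 1 ->
  `|x| <= r -> `|y| <= r -> `|y + s *: (x - y)| <= r.
Proof.
move=> /andP[s0 s1] xr yr.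
have -> : y + s *: (x - y) = (1 - s) *: y + s *: x.
  by rewrite scalerBr scalerBl scale1r addrA addrAC.
rewrite (le_trans (ler_normD _ _))// !normrZ ger0_norm ?subr_ge0// ger0_norm//.
have : (1 - s) * `|y| <= (1 - s) * r by rewrite ler_wpM2l// subr_ge0.
have : s * `|x| <= s * r by rewrite ler_wpM2l.
lra.
Qed.

Lemma segment_dist_le n (x y : 'cV[R]_n) s : 0 <= s <= 1 ->
  `|y + s *: (x - y) - y| <= `|x - y|.
Proof.
move=> /andP[s0 s1]; rewrite addrC addKr normrZ ger0_norm//.
by rewrite ler_piMl.
Qed.

(** Vectorizing permutes entries and keeps the max norm, so bounds on [jac2] control the Jacobian
    itself. *)
Lemma mx_norm_mxvec m n (A : 'M[R]_(m, n)) : `|(mxvec A)^T| = `|A|.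
Proof.
rewrite mx_norm_tr; apply/eqP; rewrite eq_le; apply/andP; split;
  apply: mx_norm_leP => // i j.
  by rewrite ord1; case/mxvec_indexP: j => j k; rewrite mxvecE mx_norm_entry.
by rewrite -mxvecE mx_norm_entry.
Qed.

Lemma jac_lipschitz n m (h : 'cV[R]_n -> 'cV[R]_m) M : C2 h ->
  (forall z, `|jac2 h z| <= M) -> forall x y,
  `|jac h x - jac h y| <= n%:R * M * `|x - y|.
Proof.
move=> [_ [dj _]] hM x y; rewrite -mx_norm_mxvec linearB/= linearB/=.
exact: (mean_value_le dj (fun s _ => hM _)).
Qed.

End matrix_calculus.

(** * Local estimates from condition (N) *)

Section nemytskii.
Context {R : realType} {nx ng n : nat}.
Implicit Types (p : 'cV[R]_nx -> 'cV[R]_ng -> 'cV[R]_n).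

Definition jacx p x g : 'M[R]_(n, nx) := jac (p ^~ g) x.
Definition jacg p x g : 'M[R]_(n, ng) := jac (p x) g.

(** What condition (N) provides at one fixed time on one ball: [M] bounds both partial Jacobians and
    [L] is their Lipschitz constant. Differentiability is separate in the two arguments, so the
    estimates change one argument at a time. *)
Definition smooth_on_ball (r L M : R) p :=
  [/\ forall x g, differentiable (p ^~ g) x,
      forall x g, differentiable (p x) g,
      forall x g, `|x| <= r -> `|g| <= r -> `|jacx p x g| <= M /\ `|jacg p x g|
        <= M &
      forall x1 x2 g1 g2, `|x1| <= r -> `|x2| <= r -> `|g1| <= r ->
        `|g2| <= r ->
        `|jacx p x1 g1 - jacx p x2 g2| + `|jacg p x1 g1 - jacg p x2 g2|
          <= L * (`|x1 - x2| + `|g1 - g2|)].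

Lemma smooth_lipschitz r L M p x1 x2 g1 g2 : smooth_on_ball r L M p ->
  `|x1| <= r -> `|x2| <= r -> `|g1| <= r -> `|g2| <= r ->
  `|p x1 g1 - p x2 g2| <= (nx + ng)%:R * M * (`|x1 - x2| + `|g1 - g2|).
Proof.
move=> [dx dg bM _] x1r x2r g1r g2r.
have M0 : 0 <= M by rewrite (le_trans _ (bM x1 g1 _ _).1).
have -> : p x1 g1 - p x2 g2 = (p x1 g1 - p x2 g1) + (p x2 g1 - p x2 g2).
  by rewrite addrA subrK.
rewrite (le_trans (ler_normD _ _))//.
have H1 : `|p x1 g1 - p x2 g1| <= nx%:R * M * `|x1 - x2|.
  apply: (@mean_value_le _ _ _ (p ^~ g1)) => [z|s s01]; first exact: dx.
  by apply: (bM _ _ _ _).1 => //; exact: segment_norm_le.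
have H2 : `|p x2 g1 - p x2 g2| <= ng%:R * M * `|g1 - g2|.
  apply: (@mean_value_le _ _ _ (p x2)) => [z|s s01]; first exact: dg.
  by apply: (bM _ _ _ _).2 => //; exact: segment_norm_le.
rewrite (le_trans (lerD H1 H2))// natrD.
have a1 : 0 <= ng%:R * M * `|x1 - x2| by rewrite !mulr_ge0.
have a2 : 0 <= nx%:R * M * `|g1 - g2| by rewrite !mulr_ge0.
lra.
Qed.

(** The path runs through [(x2, g1)]. On its first leg the Jacobian in [x] is taken at [g1] instead
    of [g2]; this mismatch is absorbed by the Lipschitz bound [L * d]. *)
Lemma smooth_taylor r L M p x1 x2 g1 g2 : 0 <= L -> smooth_on_ball r L M p ->
  `|x1| <= r -> `|x2| <= r -> `|g1| <= r -> `|g2| <= r ->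
  `|p x1 g1 - p x2 g2 - (jacx p x2 g2 *m (x1 - x2) + jacg p x2 g2 *m (g1 -
    g2))| <=
    (nx + ng)%:R * L * (`|x1 - x2| + `|g1 - g2|) ^+ 2.
Proof.
move=> L0 [dx dg _ bL] x1r x2r g1r g2r.
have -> : p x1 g1 - p x2 g2 - (jacx p x2 g2 *m (x1 - x2) + jacg p x2 g2 *m (g1
  - g2)) =
    (p x1 g1 - p x2 g1 - jacx p x2 g2 *m (x1 - x2)) +
    (p x2 g1 - p x2 g2 - jacg p x2 g2 *m (g1 - g2)).
  by rewrite [RHS]addrACA -opprD addrA subrK.
rewrite (le_trans (ler_normD _ _))//.
set d := `|x1 - x2| + `|g1 - g2|.
have H1 : `|p x1 g1 - p x2 g1 - jacx p x2 g2 *m (x1 - x2)| <=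
    nx%:R * (L * d) * `|x1 - x2|.
  apply: (@taylor1_le _ _ _ (p ^~ g1)) => [z|s s01]; first exact: dx.
  have := bL (x2 + s *: (x1 - x2)) x2 g1 g2 (segment_norm_le s01 x1r x2r) x2r
    g1r g2r.
  move=> H; apply: le_trans (le_trans _ H) _; first by rewrite lerDl.
  by rewrite ler_wpM2l// lerD2r segment_dist_le.
have H2 : `|p x2 g1 - p x2 g2 - jacg p x2 g2 *m (g1 - g2)| <=
    ng%:R * (L * d) * `|g1 - g2|.
  apply: (@taylor1_le _ _ _ (p x2)) => [z|s s01]; first exact: dg.
  have := bL x2 x2 (g2 + s *: (g1 - g2)) g2 x2r x2r (segment_norm_le s01 g1r
    g2r) g2r.
  move=> H; apply: le_trans (le_trans _ H) _; first by rewrite lerDr.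
  rewrite subrr normr0 add0r ler_wpM2l//.
  by rewrite (le_trans (segment_dist_le _ _ _))// lerDr.
rewrite (le_trans (lerD H1 H2))// natrD.
have d0 : 0 <= d by rewrite addr_ge0.
have a1 : 0 <= ng%:R * (L * d) * `|x1 - x2| by rewrite !mulr_ge0.
have a2 : 0 <= nx%:R * (L * d) * `|g1 - g2| by rewrite !mulr_ge0.
have -> : (nx%:R + ng%:R) * L * d ^+ 2 =
  nx%:R * (L * d) * `|x1 - x2| + nx%:R * (L * d) * `|g1 - g2| +
  (ng%:R * (L * d) * `|x1 - x2| + ng%:R * (L * d) * `|g1 - g2|).
  by rewrite -!mulrDr -/d; ring.
lra.
Qed.

(** The Jacobians are bounded at the origin by [K], and the Lipschitz estimate carries this bound to
    the whole ball. The absolute values appear because [K] and [L] come without a sign. *)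
Lemma cond_N_smooth t0 tf (phi : R -> 'cV[R]_nx -> 'cV[R]_ng -> 'cV[R]_n) r :
  0 < r -> cond_N t0 tf phi -> exists L M, [/\ 0 <= L, 0 <= M &
    \forall t \ae leb R, itv_oo t0 tf t -> smooth_on_ball r L M (phi t)].
Proof.
move=> r0 [_ reg [K HK] /(_ r r0)[L HL]].
exists `|L|, (`|K| + `|L| * (r + r)); split => //.
  by rewrite addr_ge0// mulr_ge0// addr_ge0// ltW.
apply: filterS3 reg HK HL => t reg HK HL It.
have [dx dg _ _] := reg It; have [Kx Kg] := HK It; have {}HL := HL It.
have HL' x1 x2 g1 g2 : `|x1| <= r -> `|x2| <= r -> `|g1| <= r -> `|g2| <= r ->
    `|jacx (phi t) x1 g1 - jacx (phi t) x2 g2| +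
      `|jacg (phi t) x1 g1 - jacg (phi t) x2 g2|
      <= `|L| * (`|x1 - x2| + `|g1 - g2|).
  move=> ? ? ? ?; rewrite (le_trans (HL _ _ _ _ _ _ _ _))//.
  by rewrite ler_wpM2r ?addr_ge0// ler_norm.
split => // x g xr gr.
have z0 k : `|0 : 'cV[R]_k| <= r by rewrite normr0 ltW.
have := HL' x 0 g 0 xr (z0 _) gr (z0 _).
rewrite !subr0 => H.
have H2 : `|L| * (`|x| + `|g|) <= `|L| * (r + r) by rewrite ler_wpM2l// lerD.
have D k1 k2 (A B : 'M[R]_(k1, k2)) : `|A| <= `|B| + `|A - B|.
  by rewrite -[in leLHS](subrK B A) addrC (le_trans (ler_normD _ _)).
split; apply: le_trans (D _ _ _ _) (lerD _ _).
- exact: le_trans Kx (ler_norm K).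
- by apply: le_trans H2; apply: le_trans H; rewrite lerDl.
- exact: le_trans Kg (ler_norm K).
- by apply: le_trans H2; apply: le_trans H; rewrite lerDr.
Qed.

End nemytskii.

(** * Geometric limits and Gronwall's inequality *)

Section ode.
Context {R : realType}.
Local Notation mu := (leb R).
Implicit Types (a b c r s t : R).

(** Serves to pass to the limit in estimates for Picard iterates: an inequality with an error of
    order [2 ^- k] for every [k] becomes exact. *)
Lemma le_geometric0 (y c : R) : (forall k, y <= c / 2 ^+ k) -> y <= 0.
Proof.
move=> H; apply/ler_addgt0Pr => e e0; rewrite add0r.
have c0 : 0 < `|c| + 1 by rewrite ltr_wpDl.
have ec : 0 < e / (`|c| + 1) by rewrite divr_gt0.
near \oo => k.
have k2 : 0 < 2 ^+ k :> R by rewrite exprn_gt0.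
apply: (le_trans (H k)).
have : 1 / 2 ^+ k < e / (`|c| + 1).
  by near: k; exact: (near_infty_natSinv_expn_lt (PosNum ec)).
rewrite ltr_pdivrMr// mulrAC ltr_pdivlMr// mul1r => /ltW ck.
rewrite ler_pdivrMr// (le_trans _ ck)// (le_trans (ler_norm c))// lerDl//.
Unshelve. all: by end_near. Qed.

(** The limit as the supremum of left end points of nested intervals, which yields the error bound
    at each [k] directly. *)
Definition geometric_limit (B : R) (u : nat -> R) : R :=
  sup [set u k - 2 * B / 2 ^+ k | k in [set: nat]].

(* The intervals u k +- 2 B / 2 ^ k are nested. *)
Lemma geometric_limitP B (u : nat -> R) :
  (forall k, `|u k.+1 - u k| <= B / 2 ^+ k) ->
  forall k, `|geometric_limit B u - u k| <= 2 * B / 2 ^+ k.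
Proof.
move=> uB; pose q k := 2 * B / 2 ^+ k.
(* The radius shrinks by exactly the admissible step, so each interval contains the next. *)
have qS k : q k - q k.+1 = B / 2 ^+ k.
  rewrite /q exprS; have : 2 ^+ k != 0 :> R by rewrite expf_neq0.
  by move: (2 ^+ k) => P P0; field.
have up j i : u j - q j <= u (j + i)%N - q (j + i)%N.
  elim: i => [|i IH]; first by rewrite addn0.
  rewrite addnS (le_trans IH)//; have := uB (j + i)%N; rewrite -qS ler_norml;
    lra.
have dn j i : u (j + i)%N + q (j + i)%N <= u j + q j.
  elim: i => [|i IH]; first by rewrite addn0.
  rewrite addnS (le_trans _ IH)//; have := uB (j + i)%N;
    rewrite -qS ler_norml; lra.
have q0 j : 0 <= q j.
  have := uB j; rewrite /q -mulrA => /(le_trans (normr_ge0 _)) ?.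
  by rewrite mulr_ge0.
have ud j k : u j - q j <= u k + q k.
  rewrite (le_trans (up j k))// (le_trans _ (dn k j))// addnC.
  by rewrite lerD2l; have := q0 (k + j)%N; lra.
move=> k; rewrite -/(q k) ler_distl; apply/andP; split.
  apply: sup_upper_bound; last by exists k.
  split; first by exists (u 0%N - q 0%N), 0%N.
  by exists (u 0%N + q 0%N) => _ [j _ <-]; exact: ud.
apply: ge_sup; first by exists (u 0%N - q 0%N), 0%N.
by move=> _ [j _ <-]; exact: ud.
Qed.

Lemma is_derive_exp_line r a t :
  is_derive t 1 (fun t => expR (r * (t - a))) (r * expR (r * (t - a))).
Proof.
have Dl : is_derive t 1 (fun t => r * (t - a)) r.
  have D1 : is_derive t 1 (fun t : R => t - a) 1.
    by apply: is_derive_eq; rewrite subr0.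
  by apply: is_derive_eq; rewrite -[RHS]mulr1.
have := @is_derive1_comp _ expR (fun t => r * (t - a)) t _ _
  (is_derive_expR (r * (t - a))) Dl.
by rewrite /comp => D; apply: is_derive_eq; rewrite mulrC.
Qed.

Lemma continuous_exp_line r a : continuous (fun t => expR (r * (t - a))).
Proof.
move=> t; apply: differentiable_continuous; apply/derivable1_diffP.
by have D := is_derive_exp_line r a t; exact: ex_derive.
Qed.

Lemma Int_exp_line r a b : a <= b ->
  Int a b (fun t => r * expR (r * (t - a))) = expR (r * (b - a)) - 1.
Proof.
move=> ab.
have cE : continuous (fun t => r * expR (r * (t - a))).
  by move=> t; apply: cvgMr; exact: continuous_exp_line.
have [_ <-//] := C1_primitive a b (is_derive_exp_line r a) cE.
by rewrite subrr mulr0 expR0.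
Qed.

(* m is compared with the maximum of m(t) exp(- 2 L (t - a)): the factor 2 makes
   the integral term at most half of that maximum. *)
Lemma gronwall a b (L C : R) (m : R -> R) : a <= b -> 0 <= L -> 0 <= C ->
  {within `[a, b], continuous m} ->
  (forall t, a <= t <= b -> m t <= C + Int a t (fun s => L * m s)) ->
  forall t, a <= t <= b -> m t <= 2 * C * expR (2 * L * (b - a)).
Proof.
move=> ab L0 C0 cm mI t tab.
pose E t := expR (2 * L * (t - a)).
have cE : continuous E by exact: continuous_exp_line.
have E0 s : 0 < E s by exact: expR_gt0.
have E1 s : a <= s -> 1 <= E s.
  by move=> as_; rewrite -expR0 ler_expR mulr_ge0 ?mulr_ge0// subr_ge0.
have cmE : {within `[a, b], continuous (fun t => m t * (E t)^-1)}.
  move=> s; apply: cvgM; first exact: cm.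
  apply: cvgV; first by rewrite gt_eqF.
  exact: (continuous_subspaceT cE).
have [x xab xmax] := EVT_max ab cmE.
set S := m x * (E x)^-1 in xmax.
have mS s : a <= s <= b -> m s <= S * E s.
  by move=> sab; rewrite -ler_pdivrMr// xmax// in_itv.
(* At the maximizer [x] the hypothesis gives [S * E x <= C + S / 2 * (E x - 1)]; since [E x >= 1],
   dividing by [E x] leaves [S / 2 <= C]. *)
have S2C : 0 <= S -> S <= 2 * C.
  move=> S0; have /andP[ax xb] : a <= x <= b by move: xab; rewrite in_itv.
  have := mI x; rewrite ax xb => /(_ isT).
  have -> : m x = S * E x by rewrite /S mulfVK// gt_eqF.
  have lm : Linfty a x m by apply: LinftyS (continuous_Linfty cm).
  have lEx r : Linfty a x (fun s => r * expR (2 * L * (s - a))).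
    apply: (@LinftyM _ _ _ (cst r)); first exact: Linfty_cst.
    exact/continuous_Linfty/continuous_subspaceT.
  have : Int a x (fun s => L * m s) <=
      Int a x (fun s => S / 2 * (2 * L * expR (2 * L * (s - a)))).
    apply: Int_le.
    - by apply/Linfty_intg/(@LinftyM _ _ _ (cst L)) => //; exact: Linfty_cst.
    - apply/Linfty_intg/(@LinftyM _ _ _ (cst (S / 2))); first exact: Linfty_cst.
      exact: lEx.
    - apply: aeW => s; rewrite itv_ooE => /andP[as_ sx].
      have -> : S / 2 * (2 * L * expR (2 * L * (s - a))) = L * (S * E s).
        by rewrite /E; field.
      rewrite ler_wpM2l// mS//; apply/andP; split; first exact: ltW.
      by rewrite (le_trans (ltW sx)).
  rewrite (@IntZ _ a x (S / 2) (fun s => 2 * L * expR (2 * L * (s - a))));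
    last by exact/Linfty_intg/lEx.
  rewrite Int_exp_line// -/(E x) => H1 H2.
  have H3 : S * E x <= C + S / 2 * E x.
    have := divr_ge0 S0 (ler0n R 2); lra.
  have H4 : S / 2 * E x <= C * E x.
    have : C <= C * E x by rewrite ler_peMr// E1.
    lra.
  by move: H4; rewrite ler_pM2r//; lra.
have /andP[at_ tb] := tab.
apply: (le_trans (mS _ tab)); apply: (@le_trans _ _ (2 * C * E t)).
  rewrite ler_wpM2r ?(ltW (E0 _))//; have [/S2C//|/ltW S0] := leP 0 S.
  by rewrite (le_trans S0)// mulr_ge0.
rewrite ler_wpM2l ?mulr_ge0// ler_expR ler_wpM2l ?mulr_ge0//; lra.
Qed.

End ode.

Lemma mx_norm_entryB (R : realFieldType) m n (A B : 'M[R]_(m, n)) i j :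
  `|A i j - B i j| <= `|A - B|.
Proof. by have := mx_norm_entry (A - B) i j; rewrite !mxE. Qed.

(** * Vector-valued primitives and their relation to [W1oo_derivative] *)

Section vector_primitive.
Context {R : realType} (n : nat).
Local Notation mu := (leb R).
Implicit Types (a b r s t M : R) (u w : R -> 'cV[R]_n).

Definition vprimitive a b u w :=
  forall i, primitive a b (fun t => u t i 0) (fun t => w t i 0).

Lemma vprimitive_norm_le a b u w (k : R -> R) : vprimitive a b u w ->
  intg a b k -> (\forall t \ae mu, itv_oo a b t -> `|w t| <= k t) ->
  forall s t, a <= s -> s <= t -> t <= b -> `|u t - u s| <= Int s t k.
Proof.
move=> uw ik wk s t as_ st tb.
have ik' : intg s t k by exact: intgS ik.
have wk' : \forall t0 \ae mu, itv_oo s t t0 -> `|w t0| <= k t0.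
  apply: filterS wk => z wk zst; apply: wk; move: zst.
  by rewrite !itv_ooE => /andP[sz zt]; rewrite (le_lt_trans as_ sz)
    (lt_le_trans zt tb).
apply: cV_norm_leP => [|i].
  apply: Int_ge0 => //; apply: filterS wk' => z wk' zst.
  by rewrite (le_trans (normr_ge0 _) (wk' zst)).
have [lw E] := uw i; rewrite !mxE E//; apply: Int_norm_le => //.
  exact/Linfty_intg/(LinftyS _ _ lw).
by apply: filterS wk' => z wk' /wk'; apply: le_trans; exact: mx_norm_entry.
Qed.

Lemma vprimitive_lip a b M u w : vprimitive a b u w ->
  (\forall t \ae mu, itv_oo a b t -> `|w t| <= M) ->
  forall s t, a <= s -> s <= t -> t <= b -> `|u t - u s| <= M * (t - s).
Proof.
move=> uw wM s t as_ st tb; rewrite -Int_cst//.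
apply: (vprimitive_norm_le uw _ wM) => //; exact/Linfty_intg/Linfty_cst.
Qed.

Lemma norm_within_continuous a b M u :
  (forall s t, a <= s -> s <= t -> t <= b -> `|u t - u s| <= M * (t - s)) ->
  {within `[a, b], continuous (fun t => `|u t|)}.
Proof.
move=> uM; apply: (@lipschitz_within _ _ _ M) => s t as_ st tb.
by rewrite (le_trans (ler_dist_dist _ _))// uM.
Qed.

Lemma vprimitive_ae_eq a b u w w' : vprimitive a b u w ->
  (\forall t \ae mu, itv_oo a b t -> w t = w' t) -> vprimitive a b u w'.
Proof.
move=> uw ww' i; have [lw E] := uw i.
have e : \forall t \ae mu, itv_oo a b t -> w t i 0 = w' t i 0.
  by apply: filterS ww' => t + It => /(_ It) ->.
split; first exact: Linfty_ae_eq lw e.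
move=> s t as_ st tb; rewrite E//; apply: Int_ae_eq.
  exact/Linfty_intg/(LinftyS _ _ lw).
apply: filterS e => z e zst; apply: e; move: zst.
by rewrite !itv_ooE => /andP[sz zt]; rewrite (le_lt_trans as_ sz) (lt_le_trans
  zt tb).
Qed.

Lemma vprimitiveB a b u w u' w' : vprimitive a b u w -> vprimitive a b u' w' ->
  vprimitive a b (fun t => u t - u' t) (fun t => w t - w' t).
Proof.
move=> p p' i; have := primitiveB (p i) (p' i).
congr (primitive a b _ _); apply/funext => t /=; rewrite !mxE//.
Qed.

Lemma W1oo_vprimitive t0 tf u w : t0 < tf -> W1oo_derivative t0 tf u w ->
  vprimitive t0 tf u w.
Proof.
move=> t0tf [cu H] i; have [lu lw uw] := H i.
apply: weak_derivative_primitive => //.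
move=> t; apply: (@cvg_comp _ _ _ u (fun A : 'cV[R]_n => A i 0) _ _ _ (cu t)).
exact: coord_continuous.
Qed.

Lemma cV_within_continuous (A : set R) u :
  (forall i, {within A, continuous (fun t => u t i 0)}) ->
  {within A, continuous u}.
Proof.
move=> cu t; apply/cvgrPdist_le => e e0.
have H : \forall s \near nbhs (t : subspace A), forall i, `|u t i 0 - u s i 0|
  <= e.
  apply: filter_forall => i; have /cvgrPdist_le := cu i t; exact.
apply: filterS H => s H; apply: cV_norm_leP => [|i]; first exact: ltW.
by rewrite !mxE; exact: H.
Qed.

Lemma vprimitive_W1oo t0 tf u w : t0 < tf -> vprimitive t0 tf u w ->
  W1oo_derivative t0 tf u w.
Proof.
move=> t0tf uw; split.
  by apply: cV_within_continuous => i; exact: primitive_continuous (uw i).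
move=> i; split; [exact: primitive_Linfty (uw i)|by have [] := uw i|].
exact: primitive_weak_derivative.
Qed.

End vector_primitive.

(** * Existence for Caratheodory differential equations *)

Section picard.
Context {R : realType} (n : nat).
Local Notation mu := (leb R).
Variables (a b : R) (x0 : 'cV[R]_n) (F : R -> 'cV[R]_n -> 'cV[R]_n) (K L : R).
Hypothesis ab : a <= b.
(** A curve that starts at [x0] with speed at most [K] stays in this ball, so a Lipschitz condition
    on the ball suffices for the iteration. *)
Let r := `|x0| + K * (b - a).
Hypothesis L0 : 0 <= L.
Hypothesis K0 : 0 <= K.
Hypothesis mF : forall x i, measurable_fun (itv_oo a b) (fun t : lebR R =>
  F t x i 0).
Hypothesis cF : \forall t \ae mu, itv_oo a b t -> continuous (F t).
Hypothesis bF : \forall t \ae mu, itv_oo a b t -> forall x, `|F t x| <= K.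
Hypothesis lF : \forall t \ae mu, itv_oo a b t -> forall x y, `|x| <= r ->
  `|y| <= r ->
  `|F t x - F t y| <= L * `|x - y|.

Lemma Linfty_along (x : R -> 'cV[R]_n) :
  (forall i, Linfty a b (fun t => x t i 0)) -> forall i, Linfty a b (fun t => F
    t (x t) i 0).
Proof.
move=> lx i; split; last first.
  exists K; apply: filterS bF => t bFt It.
  by rewrite (le_trans (mx_norm_entry _ _ _))// bFt.
apply: (@caratheodory_comp _ _ _ (fun t x => F t x i 0)).
- by move=> y; exact: mF.
- apply: filterS cF => t cFt It.
  apply: (@continuous_comp _ _ _ (F t) (fun A : 'cV[R]_n => A i 0)).
    exact: cFt.
  exact: coord_continuous.
- by move=> j; have [] := lx j.
Qed.

Definition picard_step (x : R -> 'cV[R]_n) : R -> 'cV[R]_n :=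
  fun t => \col_i (x0 i 0 + Int a t (fun s => F s (x s) i 0)).

Definition picard_iter k := iter k picard_step (cst x0).

Lemma picard_step_vprimitive (x : R -> 'cV[R]_n) : (forall i, Linfty a b (fun t
  => x t i 0)) ->
  vprimitive a b (picard_step x) (fun t => F t (x t)).
Proof.
move=> lx i; have := @primitive_Int R a b (x0 i 0) (fun s =>
  F s (x s) i 0) (Linfty_along lx i).
by congr (primitive a b _ _); apply/funext => t; rewrite mxE.
Qed.

Lemma picard_step_init x : picard_step x a = x0.
Proof. by apply/colP => i; rewrite mxE Int_diag addr0. Qed.

Lemma picard_step_lip (x : R -> 'cV[R]_n) : (forall i, Linfty a b (fun t =>
  x t i 0)) ->
  forall s t, a <= s -> s <= t -> t <= b ->
  `|picard_step x t - picard_step x s| <= K * (t - s).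
Proof.
move=> lx; apply: vprimitive_lip (picard_step_vprimitive lx) _.
by apply: filterS bF => t bFt It; exact: bFt.
Qed.

Lemma picard_iter_Linfty k i : Linfty a b (fun t => picard_iter k t i 0).
Proof.
elim: k i => [|k IH] i; first exact: Linfty_cst.
exact: primitive_Linfty (picard_step_vprimitive IH i).
Qed.

Lemma picard_iter_ball k t : a <= t -> t <= b -> `|picard_iter k t| <= r.
Proof.
move=> at_ tb; rewrite /r; case: k => [|k] /=.
  by rewrite lerDl mulr_ge0// subr_ge0.
have := picard_step_lip (picard_iter_Linfty k) (lexx a) at_ tb.
rewrite picard_step_init -/(picard_iter k) => H.
rewrite -(subrK x0 (picard_step _ _)) addrC (le_trans (ler_normD _ _))// lerD2l.
rewrite (le_trans H)// ler_wpM2l//; lra.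
Qed.

Let E t := expR (2 * L * (t - a)).
Let C := K * (b - a).

Let E_ge1 t : a <= t -> 1 <= E t.
Proof.
by move=> as_; rewrite -expR0 ler_expR mulr_ge0 ?mulr_ge0// subr_ge0.
Qed.

(* In the norm weighted by 1 / E the Picard operator contracts by 1 / 2. *)
Lemma picard_iter_contract k t : a <= t -> t <= b ->
  `|picard_iter k.+1 t - picard_iter k t| <= C / 2 ^+ k * E t.
Proof.
elim: k t => [|k IH] t at_ tb.
  have := picard_step_lip (picard_iter_Linfty 0) (lexx a) at_ tb.
  rewrite picard_step_init expr0 divr1 => H.
  have C0 : 0 <= C by rewrite mulr_ge0// subr_ge0.
  rewrite (le_trans H)// (@le_trans _ _ C)//; last by rewrite ler_peMr// E_ge1.
  by rewrite /C ler_wpM2l//; lra.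
have p1 := picard_step_vprimitive (picard_iter_Linfty k.+1).
have p0 := picard_step_vprimitive (picard_iter_Linfty k).
have lE : Linfty a b (fun s => 2 * L * E s).
  apply: (@LinftyM _ _ _ (cst (2 * L))); first exact: Linfty_cst.
  exact/continuous_Linfty/continuous_subspaceT/continuous_exp_line.
have C0 : 0 <= C by rewrite mulr_ge0// subr_ge0.
(* [2 * L * E] is the derivative of [E]; integrating [L] times the previous bound thus gives
   [E t - 1] with half the constant. *)
have ik : intg a b (fun s => C / 2 ^+ k.+1 * (2 * L * E s)).
  apply/Linfty_intg/(@LinftyM _ _ _ (cst (C / 2 ^+ k.+1)));
    first exact: Linfty_cst.
  exact: lE.
have wk : \forall s \ae mu, itv_oo a b s ->
    `|F s (picard_iter k.+1 s) - F s (picard_iter k s)|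
      <= C / 2 ^+ k.+1 * (2 * L * E s).
  apply: filterS lF => s lFs Is.
  have /andP[as_ sb] : a < s < b by rewrite -itv_ooE.
  apply: (le_trans (lFs Is _ _ (picard_iter_ball _ (ltW as_) (ltW sb))
     (picard_iter_ball _ (ltW as_) (ltW sb)))).
  apply: (le_trans (ler_wpM2l L0 (IH _ (ltW as_) (ltW sb)))).
  rewrite le_eqVlt; apply/orP; left; apply/eqP.
  rewrite exprS; have : 2 ^+ k != 0 :> R by rewrite expf_neq0.
  by move: (2 ^+ k) => P P0; field.
have := vprimitive_norm_le (vprimitiveB p1 p0) ik wk (lexx a) at_ tb.
rewrite !picard_step_init subrr subr0 => /le_trans; apply.
rewrite (@IntZ _ a t (C / 2 ^+ k.+1) (fun s => 2 * L * E s)); last first.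
  by apply/Linfty_intg/(LinftyS _ _ lE).
rewrite Int_exp_line// ler_wpM2l ?divr_ge0 ?exprn_ge0//.
by rewrite -/(E t) gerBl.
Qed.

Let B := C * E b.

Lemma picard_iter_geometric t i : a <= t -> t <= b -> forall k,
  `|picard_iter k.+1 t i 0 - picard_iter k t i 0| <= B / 2 ^+ k.
Proof.
move=> at_ tb k.
have C0 : 0 <= C by rewrite mulr_ge0// subr_ge0.
apply: (le_trans (mx_norm_entryB _ _ _ _)).
rewrite (le_trans (picard_iter_contract _ at_ tb))// /B mulrAC.
rewrite ler_wpM2r ?invr_ge0 ?exprn_ge0// ler_wpM2l// ler_expR.
by rewrite ler_wpM2l ?mulr_ge0//; lra.
Qed.

Definition picard_limit : R -> 'cV[R]_n := fun t =>
  \col_i geometric_limit B (fun k => picard_iter k t i 0).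

Lemma picard_limitP t k : a <= t -> t <= b ->
  `|picard_limit t - picard_iter k t| <= 2 * B / 2 ^+ k.
Proof.
move=> at_ tb.
have B0 : 0 <= B by rewrite mulr_ge0 ?expR_ge0// mulr_ge0// subr_ge0.
apply: cV_norm_leP => [|i]; first by apply: divr_ge0;
  [exact: mulr_ge0|exact: exprn_ge0].
rewrite !mxE; apply: (geometric_limitP (u := fun k => picard_iter k t i 0)).
exact: picard_iter_geometric.
Qed.

Lemma picard_limit_ball t : a <= t -> t <= b -> `|picard_limit t| <= r.
Proof.
move=> at_ tb; rewrite -subr_le0; apply: (@le_geometric0 _ _ (2 * B)) => k.
have H1 := picard_limitP k at_ tb; have H2 := picard_iter_ball k at_ tb.
have := ler_normD (picard_limit t - picard_iter k t) (picard_iter k t).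
rewrite subrK; lra.
Qed.

Lemma picard_limit_lip s t : a <= s -> s <= t -> t <= b ->
  `|picard_limit t - picard_limit s| <= K * (t - s).
Proof.
move=> as_ st tb; rewrite -subr_le0; apply: (@le_geometric0 _ _ (2 * B)) => k.
have at_ := le_trans as_ st; have sb := le_trans st tb.
have H1 := picard_limitP k.+1 at_ tb; have H2 := picard_limitP k.+1 as_ sb.
have H3 := picard_step_lip (picard_iter_Linfty k) as_ st tb.
have -> : picard_limit t - picard_limit s =
  (picard_limit t - picard_iter k.+1 t) - (picard_limit s - picard_iter k.+1 s)
    +
  (picard_iter k.+1 t - picard_iter k.+1 s).
  move: (picard_limit t) (picard_limit s) (picard_iter _ _) (picard_iter _ _)
    => ? ? ? ?.
  by apply/matrixP => i j; rewrite !mxE; ring.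
rewrite (le_trans _ (_ : 2 * (2 * B / 2 ^+ k.+1) + K * (t - s) - K * (t - s) <=
  _))//; last first.
  rewrite addrK exprS; have : 2 ^+ k != 0 :> R by rewrite expf_neq0.
  by move: (2 ^+ k) => P P0; rewrite le_eqVlt; apply/orP; left; apply/eqP;
    field.
rewrite lerD2r (le_trans (ler_normD _ _))// lerD//.
apply: le_trans (le_trans (ler_normB _ _) (lerD H1 H2)) _.
rewrite [leRHS]mulr_natl mulr2n; exact: lexx.
Qed.

Lemma picard_limit_Linfty i : Linfty a b (fun t => picard_limit t i 0).
Proof.
apply: continuous_Linfty; apply: (@lipschitz_within _ _ _ K) => s t as_ st tb.
by apply: (le_trans (mx_norm_entryB _ _ _ _)); exact: picard_limit_lip.
Qed.

(** Iterate [k.+1] is a primitive of [F] along iterate [k]. Replacing both iterates by the limit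
    costs two endpoint errors and, by the Lipschitz condition, one integral error, all of order
    [2 ^- k]. *)
Lemma picard_limit_vprimitive :
  vprimitive a b picard_limit (fun t => F t (picard_limit t)).
Proof.
have lx := picard_limit_Linfty; move=> i.
have lFx := Linfty_along lx; split => // s t as_ st tb.
have at_ := le_trans as_ st; have sb := le_trans st tb.
have B0 : 0 <= B.
  by rewrite mulr_ge0 ?expR_ge0// mulr_ge0// subr_ge0.
apply/eqP; rewrite -subr_eq0 -normr_le0.
apply: (@le_geometric0 _ _ (2 * B + L * (2 * B) * (t - s))) => k.
have lFk := Linfty_along (picard_iter_Linfty k).
have [_ Ek] := picard_step_vprimitive (picard_iter_Linfty k) i.
have := Ek s t as_ st tb => {}Ek.
have H1 := picard_limitP k.+1 at_ tb; have H2 := picard_limitP k.+1 as_ sb.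
have G1 := mx_norm_entryB (picard_limit t) (picard_iter k.+1 t) i 0.
have G2 := mx_norm_entryB (picard_limit s) (picard_iter k.+1 s) i 0.
have H3 : `|Int s t (fun z => F z (picard_iter k z) i 0) -
    Int s t (fun z => F z (picard_limit z) i 0)| <= L * (2 * B / 2 ^+ k) * (t -
      s).
  rewrite -IntB; [|exact/Linfty_intg/(LinftyS _ _ (lFk i))
                  |exact/Linfty_intg/(LinftyS _ _ (lFx i))].
  apply: Int_bound => //; first by apply: LinftyB; [exact: LinftyS (lFk
    i)|exact: LinftyS (lFx i)].
  apply: filterS lF => z lFz; rewrite itv_ooE => /andP[sz zt].
  have az : a <= z by rewrite (le_trans as_)// ltW.
  have zb : z <= b by rewrite (le_trans _ tb)// ltW.
  have Iz : itv_oo a b z by rewrite itv_ooE (le_lt_trans as_ sz) (lt_le_trans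
    zt tb).
  have := lFz Iz _ _ (picard_iter_ball k az zb) (picard_limit_ball az zb).
  have := mx_norm_entryB (F z (picard_iter k z)) (F z (picard_limit z)) i 0.
  move=> J1 J2; rewrite (le_trans J1)// (le_trans J2)//.
  by rewrite ler_wpM2l// distrC picard_limitP.
have -> : picard_limit t i 0 - picard_limit s i 0 - Int s t (fun z =>
  F z (picard_limit z) i 0)
  = (picard_limit t i 0 - picard_iter k.+1 t i 0) -
    (picard_limit s i 0 - picard_iter k.+1 s i 0) +
    (Int s t (fun z => F z (picard_iter k z) i 0) -
     Int s t (fun z => F z (picard_limit z) i 0)).
  by rewrite -Ek /=; ring.
rewrite (le_trans (ler_normD _ _))//.
have -> : (2 * B + L * (2 * B) * (t - s)) / 2 ^+ k =
    2 * B / 2 ^+ k.+1 + 2 * B / 2 ^+ k.+1 + L * (2 * B / 2 ^+ k) * (t - s).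
  rewrite exprS; have : 2 ^+ k != 0 :> R by rewrite expf_neq0.
  by move: (2 ^+ k) => P P0; field.
rewrite lerD// (le_trans (ler_normB _ _))// lerD//.
  exact: le_trans G1 H1.
exact: le_trans G2 H2.
Qed.

Lemma caratheodory_existence : exists x : R -> 'cV[R]_n,
  vprimitive a b x (fun t => F t (x t)) /\ x a = x0.
Proof.
exists picard_limit; split; first exact: picard_limit_vprimitive.
apply/eqP; rewrite -subr_eq0 -normr_le0; apply: (@le_geometric0 _ _ (2 * B)) =>
  k.
have := picard_limitP k (lexx a) ab.
by case: k => [//|k] /=; rewrite picard_step_init.
Qed.

End picard.

(** * Models in [G2] at almost every time *)

Section models.
Context {R : realType} (t0 tf : R) {nx ng : nat}.
Local Notation mu := (leb R).
Local Notation I := (itv_oo t0 tf).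
Local Notation model := (R -> 'cV[R]_nx -> 'cV[R]_ng).

(** Rests on the line having positive measure: over a null space the essential supremum would be
    [-oo]. *)
Lemma ess_sup_sup_ge0 m n (h : R -> 'cV[R]_nx -> 'M[R]_(m, n)) :
  (0 <= ess_sup_sup t0 tf h)%E.
Proof.
apply: ess_sup_gee; first exact: leb_setT_gt0.
apply: aeW => t; rewrite patchE; case: ifPn => // _.
apply: (@le_trans _ _ (`|h t 0|%:E)%E); first by rewrite lee_fin.
by apply: ereal_sup_ubound; exists 0.
Qed.

Lemma ess_sup_sup_ge m n (h : R -> 'cV[R]_nx -> 'M[R]_(m, n)) :
  \forall t \ae mu, I t -> forall x, (`|h t x|%:E <= ess_sup_sup t0 tf h)%E.
Proof.
have := @ess_sup_ge _ _ _ mu ((fun t : lebR R =>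
  ereal_sup [set `|h t x|%:E | x in [set: 'cV[R]_nx]]) \_ I).
apply: filterS => t + It x; rewrite patchE ifT ?inE//; apply: le_trans.
by apply: ereal_sup_ubound; exists x.
Qed.

Lemma G2_norm_ge0 (g : model) : 0 <= G2_norm t0 tf g.
Proof.
by rewrite fine_ge0// !adde_ge0//; exact: ess_sup_sup_ge0.
Qed.

Definition C2_bounded (N : R) (h : 'cV[R]_nx -> 'cV[R]_ng) :=
  [/\ C2 h, forall x, `|h x| <= N, forall x, `|jac h x| <= N &
      forall x, `|jac2 h x| <= N].

(** The three essential suprema are nonnegative, so their sum dominates each of them and one
    constant bounds all derivatives. *)
Lemma G2_C2_bounded (g : model) : G2 t0 tf g ->
  \forall t \ae mu, I t -> C2_bounded (G2_norm t0 tf g) (g t).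
Proof.
move=> [C2g _ gfin].
have fin : G2_enorm t0 tf g \is a fin_num.
  by rewrite ge0_fin_numE// !adde_ge0//; exact: ess_sup_sup_ge0.
have H0 := ess_sup_sup_ge0 (m := ng) (n := 1) g.
have H1 := ess_sup_sup_ge0 (fun t => jac (g t)).
have H2 := ess_sup_sup_ge0 (fun t => jac2 (g t)).
have B0 := ess_sup_sup_ge (m := ng) (n := 1) g.
have B1 := ess_sup_sup_ge (fun t => jac (g t)).
have B2 := ess_sup_sup_ge (fun t => jac2 (g t)).
have NE : (G2_norm t0 tf g)%:E = G2_enorm t0 tf g by rewrite fineK.
have B12 : \forall t \ae mu, I t ->
  (forall x, (`|jac (g t) x|%:E <= ess_sup_sup t0 tf (fun t => jac (g t)))%E) /\
  (forall x, (`|jac2 (g t) x|%:E <= ess_sup_sup t0 tf (fun t => jac2 (g t)))%E).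
  by apply: filterS2 B1 B2 => t B1 B2 It; split; [exact: B1|exact: B2].
apply: filterS3 C2g B0 B12 => t C2g B0 B12 It.
have [{}B1 {}B2] := B12 It; split => [|x|x|x]; first exact: C2g.
- rewrite -lee_fin NE (le_trans (B0 It x))// /G2_enorm -addeA leeDl//.
  exact: adde_ge0.
- by rewrite -lee_fin NE (le_trans (B1 x))// /G2_enorm addeAC leeDr// adde_ge0.
- by rewrite -lee_fin NE (le_trans (B2 x))// /G2_enorm leeDr// adde_ge0.
Qed.

Lemma C2_bounded_lipschitz N h x y : C2_bounded N h ->
  `|h x - h y| <= nx%:R * N * `|x - y|.
Proof.
move=> [[[dh _] _] _ hN _]; apply: mean_value_le => // s _; exact: hN.
Qed.

Lemma C2_bounded_taylor N h x y : C2_bounded N h ->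
  `|h x - h y - jac h y *m (x - y)| <= nx%:R * (nx%:R * N * `|x - y|) * `|x -
    y|.
Proof.
move=> [C2h _ _ hN]; have [[dh _] _] := C2h.
have N0 : 0 <= N by exact: le_trans (hN 0).
apply: taylor1_le => // s s01.
rewrite (le_trans (jac_lipschitz C2h hN _ _))// ler_wpM2l//.
  by rewrite mulr_ge0.
exact: segment_dist_le.
Qed.

Lemma C2_continuous (h : 'cV[R]_nx -> 'cV[R]_ng) : C2 h -> continuous h.
Proof. by move=> [[dh _] _] x; exact: differentiable_continuous. Qed.

(* The properties of a model that are used to solve the state equation; unlike
   G2, they are clearly stable under addition. *)
Definition tame (M N : R) (g : model) :=
  (forall x, measurable_vec t0 tf (fun t => g t x)) /\
  \forall t \ae mu, I t -> [/\ continuous (g t), forall x, `|g t x| <= M &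
    forall x y, `|g t x - g t y| <= N * `|x - y|].

Lemma G2_tame (g : model) : G2 t0 tf g ->
  tame (G2_norm t0 tf g) (nx%:R * G2_norm t0 tf g) g.
Proof.
move=> Gg; split; first by case: Gg.
apply: filterS (G2_C2_bounded Gg) => t H /H{}H; split.
- by case: H => /C2_continuous.
- by case: H.
- by move=> x y; exact: C2_bounded_lipschitz.
Qed.

Lemma tameD M N M' N' (g d : model) : tame M N g -> tame M' N' d ->
  tame (M + M') (N + N') (g + d).
Proof.
move=> [mg Hg] [md Hd]; split.
  move=> x i; have := measurable_funD (mg x i) (md x i).
  by apply: eq_measurable_fun => t _; rewrite !mxE.
apply: filterS2 Hg Hd => t Hg Hd It.
have [cg bg lg] := Hg It; have [cd bd ld] := Hd It; split.
- by move=> x; exact: cvgD (cg x) (cd x).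
- by move=> x; rewrite (le_trans (ler_normD _ _))// lerD.
- move=> x y; rewrite opprD addrACA (le_trans (ler_normD _ _))//.
  by rewrite mulrDl lerD.
Qed.

(** Substituting the curves one after the other asks only for separate continuity, which partial
    differentiability supplies. *)
Lemma measurable_along2 (p : R -> 'cV[R]_nx -> 'cV[R]_ng -> R)
    (x : R -> 'cV[R]_nx) (g : R -> 'cV[R]_ng) :
  (forall y z, measurable_fun I (fun t : lebR R => p t y z)) ->
  (\forall t \ae mu, I t -> (forall z, continuous (p t ^~ z)) /\
    forall y, continuous (p t y)) ->
  measurable_vec t0 tf x -> measurable_vec t0 tf g ->
  measurable_fun I (fun t : lebR R => p t (x t) (g t)).
Proof.
move=> mp cp mx mg.
apply: (@caratheodory_comp _ _ _ (fun t z => p t (x t) z)); last exact: mg.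
- move=> z; apply: (@caratheodory_comp _ _ _ (fun t y => p t y z));
  last exact: mx.
    by move=> y; exact: mp.
  by apply: filterS cp => t + It => /(_ It)[+ _]; exact.
- by apply: filterS cp => t + It => /(_ It)[_]; exact.
Qed.

Lemma measurable_along (g : model) (x : R -> 'cV[R]_nx) :
  (forall y, measurable_vec t0 tf (fun t => g t y)) ->
  (\forall t \ae mu, I t -> continuous (g t)) ->
  measurable_vec t0 tf x -> measurable_vec t0 tf (fun t => g t (x t)).
Proof.
move=> mg cg mx i.
apply: (@caratheodory_comp _ _ _ (fun t y => g t y i 0)); last exact: mx.
  by move=> y; exact: mg.
apply: filterS cg => t cgt It.
apply: (@continuous_comp _ _ _ (g t) (fun A : 'cV[R]_ng => A i 0));
  first exact: cgt.
exact: coord_continuous.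
Qed.

End models.

Lemma continuous_comp2 (S T U V : topologicalType) (h : T -> U -> V)
    (u : S -> T) (v : S -> U) :
  continuous (fun p : T * U => h p.1 p.2) -> continuous u -> continuous v ->
  continuous (fun z => h (u z) (v z)).
Proof.
move=> ch cu cv z; apply: (@continuous2_cvg _ _ _ _ (nbhs z) _ u v h).
- exact: (ch (u z, v z)).
- exact: cu.
- exact: cv.
Qed.

(** * The state equation: a priori bound, existence and stability *)

Section state.
Context {R : realType} (t0 tf : R) {nx ng : nat}.
Local Notation mu := (leb R).
Local Notation I := (itv_oo t0 tf).
Local Notation model := (R -> 'cV[R]_nx -> 'cV[R]_ng).
Variables (x0 : 'cV[R]_nx) (f : R -> 'cV[R]_nx -> 'cV[R]_ng ->
  'cV[R]_nx) (Mf : R).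
Hypothesis t0tf : t0 < tf.
Hypothesis mf : forall x g, measurable_vec t0 tf (fun t => f t x g).
Hypothesis cf : \forall t \ae mu, I t ->
  continuous (fun p : 'cV[R]_nx * 'cV[R]_ng => f t p.1 p.2).
Hypothesis Mf0 : 0 <= Mf.
Hypothesis bf : \forall t \ae mu, I t -> forall x g, `|f t x g| <= Mf * (1 +
  `|g|).
Hypothesis Nf : cond_N t0 tf f.

(** Along a model bounded by [M] the speed is at most [Mf * (1 + M)]; this is the ball reached from
    [x0] in time [tf - t0]. *)
Definition state_radius M := `|x0| + Mf * (1 + M) * (tf - t0).

Lemma is_state_vprimitive (g : model) x : is_state t0 tf f x0 g x ->
  vprimitive t0 tf x (fun t => f t (x t) (g t (x t))).
Proof.
move=> [[w xw wE] _]; apply: vprimitive_ae_eq (wE).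
exact: W1oo_vprimitive.
Qed.

Lemma is_state_ball M N (g : model) x : 0 <= M -> tame t0 tf M N g ->
  is_state t0 tf f x0 g x -> forall t, t0 <= t <= tf ->
    `|x t| <= state_radius M.
Proof.
move=> M0 [_ bg] sx t /andP[t0t ttf].
have H := vprimitive_lip (is_state_vprimitive sx).
have K0 : 0 <= Mf * (1 + M) by rewrite mulr_ge0// addr_ge0.
have : `|x t - x t0| <= Mf * (1 + M) * (t - t0).
  apply: H => //; apply: filterS2 bf bg => s bfs bgs Is.
  have [_ bgs' _] := bgs Is.
  by rewrite (le_trans (bfs Is _ _))// ler_wpM2l// lerD2l.
have [_ ->] := sx => H1.
rewrite -(subrK x0 (x t)) addrC (le_trans (ler_normD _ _))// lerD2l.
by rewrite (le_trans H1)// ler_wpM2l//; lra.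
Qed.

Lemma state_exists M N (g : model) : 0 <= M -> 0 <= N -> tame t0 tf M N g ->
  is_state t0 tf f x0 g (state t0 tf f x0 g).
Proof.
move=> M0 N0 [mg bg]; rewrite /state; apply: xgetPex.
pose F t x := f t x (g t x); pose K := Mf * (1 + M).
have K0 : 0 <= K by rewrite mulr_ge0// addr_ge0.
pose r := `|x0| + K * (tf - t0).
have r0 : 0 <= r by rewrite addr_ge0// mulr_ge0// subr_ge0 ltW.
(* The ball has to contain the states, of norm at most [r], and the model values, of norm at most
   [M]; the summand 1 makes the radius positive for condition (N). *)
have rho0 : 0 < r + M + 1 by rewrite ltr_wpDl// addr_ge0.
have [L [Lam [L0 Lam0 HN]]] := cond_N_smooth rho0 Nf.
pose Lip := (nx + ng)%:R * Lam * (1 + N).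
have Lip0 : 0 <= Lip by rewrite mulr_ge0 ?mulr_ge0// addr_ge0.
have mF x i : measurable_fun I (fun t : lebR R => F t x i 0).
  apply: (@caratheodory_comp _ _ _ (fun t z => f t x z i 0)); last exact: mg.
    by move=> z; exact: mf.
  apply: filterS cf => t cft It.
  apply: (@continuous_comp _ _ _ (f t x) (fun A : 'cV[R]_nx => A i 0));
    last exact: coord_continuous.
  have ci : continuous (fun z : 'cV[R]_ng => z) by move=> z; exact: cvg_id.
  exact: (continuous_comp2 (cft It) (fun z => cvg_cst x) ci).
have cF : \forall t \ae mu, I t -> continuous (F t).
  apply: filterS2 cf bg => t cft bgt It x; have [cg _ _] := bgt It.
  have ci : continuous (fun z : 'cV[R]_nx => z) by move=> z; exact: cvg_id.
  exact: (continuous_comp2 (cft It) ci cg).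
have bF : \forall t \ae mu, I t -> forall x, `|F t x| <= K.
  apply: filterS2 bf bg => t bft bgt It x; have [_ bgt' _] := bgt It.
  by rewrite (le_trans (bft It _ _))// ler_wpM2l// lerD2l.
have lF : \forall t \ae mu, I t -> forall x y, `|x| <= r -> `|y| <= r ->
    `|F t x - F t y| <= Lip * `|x - y|.
  apply: filterS2 HN bg => t HNt bgt It x y xr yr; have [_ bgt' lgt] := bgt It.
  have le1 (z : R) : z <= r -> z <= r + M + 1 by lra.
  have le2 (z : R) : z <= M -> z <= r + M + 1 by lra.
  rewrite (le_trans (smooth_lipschitz (HNt It) (le1 _ xr) (le1 _ yr)
    (le2 _ (bgt' _)) (le2 _ (bgt' _))))//.
  rewrite /Lip -[leRHS]mulrA ler_wpM2l ?mulr_ge0// mulrDl mul1r lerD2l;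
    exact: lgt.
have [x [xF xt0]] := caratheodory_existence (ltW t0tf) Lip0 K0 mF cF bF lF.
exists x; split => //; exists (fun t => F t (x t));
  first exact: vprimitive_W1oo.
exact: aeW.
Qed.

Lemma measurable_vec_Linfty n (x w : R -> 'cV[R]_n) : vprimitive t0 tf x w ->
  measurable_vec t0 tf x.
Proof. by move=> xw i; have [] := primitive_Linfty (xw i). Qed.

(** Writing the model difference as [(g t (x t) - g t (y t)) + d t (x t)] leaves a Lipschitz term of
    the unperturbed model and a forcing of size [D]. The exponent is therefore independent of [d],
    and the bound is linear in [D]. *)
Lemma state_stability M N D (g d : model) x y rho L Lam :
  0 <= M -> 0 <= N -> 0 <= D -> 0 <= Lam ->
  (\forall t \ae mu, I t -> (forall z, `|g t z| <= M) /\
     forall z z', `|g t z - g t z'| <= N * `|z - z'|) ->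
  (\forall t \ae mu, I t -> forall z, `|d t z| <= D) ->
  (forall t, t0 <= t <= tf -> `|x t| <= rho) ->
  (forall t, t0 <= t <= tf -> `|y t| <= rho) ->
  M + D <= rho ->
  (\forall t \ae mu, I t -> smooth_on_ball rho L Lam (f t)) ->
  is_state t0 tf f x0 (g + d) x -> is_state t0 tf f x0 g y ->
  forall t, t0 <= t <= tf ->
    `|x t - y t| <= 2 * ((nx + ng)%:R * Lam * D * (tf - t0)) *
      expR (2 * ((nx + ng)%:R * Lam * (1 + N)) * (tf - t0)).
Proof.
move=> M0 N0 D0 Lam0 bg bd xr yr MD sm sx sy.
set C := (nx + ng)%:R * Lam * D * (tf - t0); set Lip :=
  (nx + ng)%:R * Lam * (1 + N).
have k0 : 0 <= (nx + ng)%:R * Lam by rewrite mulr_ge0.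
have C0 : 0 <= C by rewrite mulr_ge0 ?subr_ge0 ?(ltW t0tf)// mulr_ge0.
have Lip0 : 0 <= Lip by rewrite mulr_ge0// addr_ge0.
have px := is_state_vprimitive sx; have py := is_state_vprimitive sy.
have pz := vprimitiveB px py.
pose k t := Lip * `|x t - y t| + (nx + ng)%:R * Lam * D.
have wk : \forall t \ae mu, I t ->
    `|f t (x t) ((g + d) t (x t)) - f t (y t) (g t (y t))| <= k t.
  apply: filterS3 bg bd sm => t bgt bdt smt It.
  have [bg1 bg2] := bgt It; have bd1 := bdt It.
  have tI : t0 <= t <= tf by move: It; rewrite itv_ooE => /andP[/ltW-> /ltW->].
  have gd : `|(g + d) t (x t)| <= rho.
    apply: le_trans (le_trans (ler_normD _ _) (lerD (bg1 _) (bd1 _))) MD.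
  have gy : `|g t (y t)| <= rho.
    by rewrite (le_trans (bg1 _))// (le_trans _ MD)// lerDl.
  rewrite (le_trans (smooth_lipschitz (smt It) (xr _ tI) (yr _ tI) gd gy))//.
  rewrite /k /Lip -[X in _ <= X + _]mulrA -mulrDr ler_wpM2l// mulrDl mul1r
    -[leRHS]addrA lerD2l.
  have -> : (g + d) t (x t) - g t (y t) = (g t (x t) - g t (y t)) + d t (x t).
    by rewrite addrAC.
  by rewrite (le_trans (ler_normD _ _))// lerD.
(* A crude Lipschitz bound from the balls; it gives the continuity that [gronwall] asks for. *)
have [Mz Mz0 lz] : exists2 Mz, 0 <= Mz & forall s t, t0 <= s -> s <= t ->
  t <= tf ->
    `|(x t - y t) - (x s - y s)| <= Mz * (t - s).
  exists (Lip * (rho + rho) + (nx + ng)%:R * Lam * D).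
    have rho0 : 0 <= rho by rewrite (le_trans _ MD)// addr_ge0.
    by rewrite addr_ge0 ?mulr_ge0// addr_ge0.
  apply: (vprimitive_lip pz); apply: filterS wk => t wkt It.
  rewrite (le_trans (wkt It))// /k lerD2r ler_wpM2l//.
  have tI : t0 <= t <= tf by move: It; rewrite itv_ooE => /andP[/ltW-> /ltW->].
  by rewrite (le_trans (ler_normB _ _))// lerD ?xr ?yr.
have cz := norm_within_continuous (u := fun t => x t - y t) lz.
have lkz : Linfty t0 tf (fun t => Lip * `|x t - y t|).
  apply: (@LinftyM _ _ _ (cst Lip)); first exact: Linfty_cst.
  exact: continuous_Linfty.
have lkc : Linfty t0 tf (fun t => (nx + ng)%:R * Lam * D) by exact: Linfty_cst.
apply: (gronwall (ltW t0tf) Lip0 C0 cz) => t /andP[t0t ttf].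
have ik : intg t0 tf k by apply: Linfty_intg; exact: LinftyD.
have := vprimitive_norm_le pz ik wk (lexx _) t0t ttf.
have [_ ->] := sx; have [_ ->] := sy.
rewrite subrr subr0 => H; rewrite (le_trans H)//.
rewrite (@IntD _ t0 t (fun t => Lip * `|x t - y t|) (fun=> (nx + ng)%:R * Lam *
  D)).
- rewrite addrC lerD2r Int_cst// /C ler_wpM2l//; first by rewrite mulr_ge0.
  lra.
- by apply/Linfty_intg; apply: LinftyS lkz.
- by apply/Linfty_intg; apply: LinftyS lkc.
Qed.

End state.

(** * Second order expansion of a function composed with a perturbed model *)

Section expansion.
Context {R : realType} {nx ng n : nat}.

(** The first summand is the Taylor remainder of [p], where the two arguments move by at most
    [C * D] and [(nx%:R * N * C + 1) * D]. The second is the Jacobian in [g] applied to the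
    remainder of the model. *)
Definition expansion_const (L M N C : R) : R :=
  (nx + ng)%:R * L * (C + (nx%:R * N * C + 1)) ^+ 2 +
  ng%:R * M * (nx%:R * (nx%:R * N * C) * C + nx%:R * C).

Lemma smooth_expansion (r L M N D C : R) (p : 'cV[R]_nx -> 'cV[R]_ng ->
  'cV[R]_n)
    (g d : 'cV[R]_nx -> 'cV[R]_ng) (x y : 'cV[R]_nx) :
  0 <= L -> 0 <= M -> smooth_on_ball r L M p -> C2_bounded N g ->
    C2_bounded D d ->
  N + D <= r -> `|x| <= r -> `|y| <= r -> `|x - y| <= C * D ->
  `|p x (g x + d x) - p y (g y) -
     ((jacx p y (g y) + jacg p y (g y) *m jac g y) *m (x - y) + jacg p y (g y)
       *m d y)|
  <= expansion_const L M N C * D ^+ 2.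
Proof.
move=> L0 M0 sp Cg Cd ND xr yr xyD.
have [_ gN _ _] := Cg; have [_ dD _ _] := Cd.
have N0 : 0 <= N by exact: le_trans (gN 0).
have D0 : 0 <= D by exact: le_trans (dD 0).
have gdr : `|g x + d x| <= r.
  by rewrite (le_trans (ler_normD _ _))// (le_trans _ ND)// lerD.
have gr : `|g y| <= r by rewrite (le_trans (gN _))// (le_trans _ ND)// lerDl.
have T := smooth_taylor L0 sp xr yr gdr gr.
have G1 := C2_bounded_lipschitz x y Cg.
have G2 := C2_bounded_taylor x y Cg.
have G3 := C2_bounded_lipschitz x y Cd.
have Mg : `|jacg p y (g y)| <= M by have [_ _ bM _] := sp;
  exact: (bM _ _ yr gr).2.
set Jx := jacx p y (g y) in T *; set Jg := jacg p y (g y) in T Mg *.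
set z := x - y in xyD T G1 G2 G3 *.
set e := g x + d x - g y in T *.
(* [rho] is the second order part of the change of the model value: the Taylor remainder of [g], and
   [d x - d y], which is quadratic in [D] because [d] has Lipschitz constant [nx%:R * D]. *)
pose rho := (g x - g y - jac g y *m z) + (d x - d y).
have eE : e = jac g y *m z + d y + rho.
  rewrite /e /rho; move: (jac g y *m z) (g x) (g y) (d x) (d y) => ? ? ? ? ?.
  by apply/matrixP => i j; rewrite !mxE; ring.
have z0 := normr_ge0 z; have CD0 : 0 <= C * D by exact: le_trans xyD.
have eD : `|z| + `|e| <= (C + (nx%:R * N * C + 1)) * D.
  have -> : e = (g x - g y) + d x by rewrite /e addrAC.
  have : nx%:R * N * `|z| <= nx%:R * N * (C * D) by rewrite ler_wpM2l//
    mulr_ge0.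
  move: (ler_normD (g x - g y) (d x)) (dD x) G1 xyD.
  move: `|_ + _| `|g x - g y| `|d x| `|z| => ? ? ? ?; lra.
have rhoD : `|rho| <= (nx%:R * (nx%:R * N * C) * C + nx%:R * C) * D ^+ 2.
  have H1 : `|z| * `|z| <= (C * D) * (C * D) by rewrite ler_pM.
  have H2 : nx%:R * D * `|z| <= nx%:R * D * (C * D) by rewrite ler_wpM2l//
    mulr_ge0.
  have H3 : nx%:R * (nx%:R * N) * (`|z| * `|z|) <= nx%:R * (nx%:R * N) * ((C *
    D) * (C * D)).
    by rewrite ler_wpM2l// !mulr_ge0.
  apply: (le_trans (ler_normD _ _)); apply: (le_trans (lerD G2 G3)).
  move: H2 H3; move: `|z| => Z; lra.
have -> : p x (g x + d x) - p y (g y) - ((Jx + Jg *m jac g y) *m z + Jg *m d y)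
  =
    (p x (g x + d x) - p y (g y) - (Jx *m z + Jg *m e)) + Jg *m rho.
  have -> : Jg *m rho = Jg *m e - Jg *m (jac g y *m z) - Jg *m d y.
    have cancel (a b c : 'cV[R]_ng) : a = b + c + a - b - c.
      by apply/matrixP => i j; rewrite !mxE; ring.
    by rewrite -!mulmxBr eE; congr (_ *m _); exact: cancel.
  rewrite mulmxDl -mulmxA; move: (Jx *m z) (Jg *m e) (Jg *m (_ *m _)) (Jg *m d
    y) (p _ _) (p _ _).
  by move=> ? ? ? ? ? ?; apply/matrixP => i j; rewrite !mxE; ring.
rewrite (le_trans (ler_normD _ _))// /expansion_const mulrDl lerD//.
  rewrite (le_trans T)// -[leRHS]mulrA ler_wpM2l ?mulr_ge0//.
  have s0 : 0 <= `|z| + `|e| by rewrite addr_ge0.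
  by rewrite -exprMn !expr2 ler_pM.
rewrite (le_trans (mx_norm_mul _ _))// -[leRHS]mulrA ler_pM ?mulr_ge0//.
by rewrite ler_wpM2l.
Qed.

End expansion.

(** * The algebra of the adjoint equation *)

Section adjoint.
Context {R : realType} {nx ng : nat}.

Lemma dot_mulmx n (u v : 'cV[R]_n) : \sum_i u i 0 * v i 0 = (u^T *m v) 0 0.
Proof. by rewrite mxE; apply: eq_bigr => i _; rewrite mxE. Qed.

(* All terms that are linear in z alone cancel. *)
Lemma adjoint_cancellation (A : 'M[R]_nx) (B : 'M[R]_(nx, ng))
    (lx : 'M[R]_(1, nx)) (lg : 'M[R]_(1, ng)) (J : 'M[R]_(ng, nx)) (lam w z zp : 'cV[R]_nx)
    (d : 'cV[R]_ng) (dl : R) :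
  - w = A^T *m lam + lx^T + J^T *m lg^T ->
  dl + \sum_i (w i 0 * z i 0 + lam i 0 * zp i 0)
     - \sum_j (B^T *m lam + lg^T) j 0 * d j 0 =
  (dl%:M - ((lx + lg *m J) *m z + lg *m d)) 0 0 +
  \sum_i lam i 0 * (zp - (A *m z + B *m d)) i 0.
Proof.
move=> wE; have {wE}-> : w = - (A^T *m lam + lx^T + J^T *m lg^T) by rewrite -wE
  opprK.
rewrite big_split/= !dot_mulmx.
have -> : (- (A^T *m lam + lx^T + J^T *m lg^T))^T = - (lam^T *m A + lx + lg *m
  J).
  by rewrite raddfN/= !raddfD/= !trmx_mul !trmxK.
have -> : (B^T *m lam + lg^T)^T = lam^T *m B + lg.
  by rewrite raddfD/= trmx_mul !trmxK.
rewrite mulNmx !mulmxDl mulmxBr mulmxDr -!mulmxA.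
move: (lam^T *m (A *m z)) (lx *m z) (lg *m (J *m z)) (lam^T *m zp) (lam^T *m (B
  *m d)) (lg *m d).
move=> a1 a2 a3 a4 a5 a6; rewrite !mxE eqxx mulr1n; ring.
Qed.

End adjoint.

(** * Measurability and boundedness along curves *)

Section along_measurable.
Context {R : realType} (t0 tf : R).
Local Notation mu := (leb R).
Local Notation I := (itv_oo t0 tf).

Lemma cvg_harmonic_dnbhs : @harmonic R n @[n --> \oo] --> (0 : R)^'.
Proof.
move=> P [e /= e0 Pe].
have : \forall n \near \oo, n.+1%:R^-1 < e := near_infty_natSinv_lt (PosNum e0).
apply: filterS => n ne; apply: Pe; last by rewrite invr_eq0 pnatr_eq0.
by rewrite /ball_ /= sub0r normrN ger0_norm ?invr_ge0.
Qed.

Lemma jac_quotient_cvg n m (h : 'cV[R]_n -> 'cV[R]_m) x i j :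
  differentiable h x ->
  n0.+1%:R * (h (x + n0.+1%:R^-1 *: delta_mx j 0) i 0 - h x i 0) @[n0 --> \oo]
    --> jac h x i j.
Proof.
move=> dh; rewrite mxE.
have cv : k^-1 *: ((h \o shift x) (k *: delta_mx j 0) - h x) @[k --> 0^']
    --> ('d h x (delta_mx j 0) : 'cV[R]_m).
  by have := @diff_derivable _ _ _ h x (delta_mx j 0) dh; rewrite -deriveE//;
    exact.
have cvh := cvg_comp _ _ cvg_harmonic_dnbhs cv.
have cc : {for 'd h x (delta_mx j 0) : 'cV[R]_m,
    continuous (fun A : 'cV[R]_m => A i 0)} by exact: coord_continuous.
apply: cvg_trans (cvg_comp _ _ cvh cc).
apply: near_eq_cvg; apply: nearW => k /=.
by rewrite !mxE invrK [_ + x]addrC.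
Qed.

(** A Jacobian entry is the limit of difference quotients with steps [1 / k.+1]. These are evaluated
    along the curves, where they are measurable as Caratheodory compositions. *)
Lemma measurable_jacg_along nx ng n
    (p : R -> 'cV[R]_nx -> 'cV[R]_ng -> 'cV[R]_n)
    (x : R -> 'cV[R]_nx) (g : R -> 'cV[R]_ng) i j :
  (forall y z, measurable_vec t0 tf (fun t => p t y z)) ->
  (\forall t \ae mu, I t -> (forall z y, differentiable (p t ^~ z) y) /\
     forall y z, differentiable (p t y) z) ->
  measurable_vec t0 tf x -> measurable_vec t0 tf g ->
  measurable_fun I (fun t : lebR R => jacg (p t) (x t) (g t) i j).
Proof.
move=> mp dp mx mg.
have mpg g' : measurable_vec t0 tf g' -> measurable_fun I (fun t :
  lebR R => p t (x t) (g' t) i 0).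
  move=> mg'; apply: (@measurable_along2 _ _ _ _ _ (fun t y z => p t y z i 0));
    [|  |exact: mx|exact: mg'].
    by move=> y z; exact: mp.
  apply: filterS dp => t + It => /(_ It)[dx dg]; split => [z y|y z].
    apply: (@continuous_comp _ _ _ (p t ^~ z) (fun A : 'cV[R]_n => A i 0));
      last exact: coord_continuous.
    exact: differentiable_continuous.
  apply: (@continuous_comp _ _ _ (p t y) (fun A : 'cV[R]_n => A i 0));
    last exact: coord_continuous.
  exact: differentiable_continuous.
apply: (@measurable_fun_ae_cvg _ I (fun k t => k.+1%:R *
  (p t (x t) (g t + k.+1%:R^-1 *: delta_mx j 0) i 0 - p t (x t) (g t) i 0))).
  by apply: filterS dp => t + It => /(_ It)[_ dg]; exact: jac_quotient_cvg.
move=> k; apply: measurable_funM; first exact: measurable_cst.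
apply: measurable_funB; last exact: mpg.
apply: mpg => i'; apply: (@eq_measurable_fun _ _ _ _ _
  (fun t : lebR R => g t i' 0 + (k.+1%:R^-1 *: delta_mx j 0 : 'cV[R]_ng) i' 0)).
  by move=> t _; rewrite [RHS]mxE.
by apply: measurable_funD; [exact: mg|exact: measurable_cst].
Qed.

Lemma Linfty_vec_bound n (u : R -> 'cV[R]_n) :
  (forall i, Linfty t0 tf (fun t => u t i 0)) ->
  exists2 M, 0 <= M & \forall t \ae mu, I t -> `|u t| <= M.
Proof.
move=> lu; have /choice[M HM] : forall i, exists M, \forall t \ae mu, I t ->
  `|u t i 0| <= M.
  by move=> i; have [_ [M HM]] := lu i; exists M.
have s0 : 0 <= \sum_i `|M i| by rewrite sumr_ge0.
exists (\sum_i `|M i|) => //.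
have H : \forall t \ae mu, forall i, I t -> `|u t i 0| <= M i.
  by apply: filter_forall => i; exact: HM.
apply: filterS H => t H It; apply: cV_norm_leP => // i.
rewrite (le_trans (H i It))// (le_trans (ler_norm _))//.
by rewrite (bigD1 i)//= lerDl sumr_ge0.
Qed.

End along_measurable.

Lemma scalar_mx_norm (R : realFieldType) (a : R) : `|a%:M : 'cV[R]_1| = `|a|.
Proof.
apply/eqP; rewrite eq_le; apply/andP; split.
  by apply: cV_norm_leP => // i; rewrite ord1 mxE eqxx mulr1n.
by have := mx_norm_entry (a%:M : 'cV[R]_1) 0 0; rewrite mxE eqxx mulr1n.
Qed.

Lemma dot_norm_le (R : realType) n (u v : 'cV[R]_n) :
  `|\sum_i u i 0 * v i 0| <= n%:R * `|u| * `|v|.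
Proof.
rewrite dot_mulmx (le_trans (mx_norm_entry _ _ _))//.
by rewrite (le_trans (mx_norm_mul _ _))// mx_norm_tr.
Qed.

Lemma C1_remainder (R : realType) n (phi : 'cV[R]_n -> R) y (e : R) : 0 < e ->
  C1 (fun x => (phi x)%:M : 'cV[R]_1) -> exists2 del, 0 < del & forall x,
    `|x - y| <= del ->
    `|phi x - phi y - \sum_i grad phi y i 0 * (x - y) i 0| <= e * `|x - y|.
Proof.
move=> e0 [dphi cphi].
(* The divisor absorbs the factor [n] of [taylor1_le]; the added 1 covers [n = 0]. *)
have e10 : 0 < e / (n%:R + 1) by rewrite divr_gt0// ltr_wpDl.
have /cvgrPdist_le/(_ _ e10) := cphi y.
move=> /nbhs_ballP[del /= del0 H].
(* Halving passes from the open ball of continuity to a closed one. *)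
exists (del / 2); first by rewrite divr_gt0.
move=> x xy.
have T : `|(phi x)%:M - (phi y)%:M -
    jac (fun x => (phi x)%:M : 'cV[R]_1) y *m (x - y)| <= n%:R * (e / (n%:R +
      1)) * `|x - y|.
  apply: (@taylor1_le _ _ _ (fun x => (phi x)%:M : 'cV[R]_1)) => // s s01.
  rewrite distrC; apply: H; rewrite mx_norm_ball /ball_ /= distrC.
  rewrite (le_lt_trans (segment_dist_le _ _ s01))// (le_lt_trans xy)//; lra.
have -> : \sum_i grad phi y i 0 * (x - y) i 0 =
    (jac (fun x => (phi x)%:M : 'cV[R]_1) y *m (x - y)) 0 0.
  by rewrite dot_mulmx /grad trmxK.
have := le_trans (mx_norm_entry _ 0 0) T; rewrite !mxE eqxx !mulr1n.
move=> /le_trans; apply; rewrite ler_wpM2r//.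
have n0 : 0 <= n%:R :> R by [].
rewrite mulrCA ler_piMr ?(ltW e0)// ler_pdivrMr; lra.
Qed.

(** * The Fréchet derivative of the quantity of interest and its bound *)

Section derivative.
Context {R : realType} (t0 tf : R) {nx ng : nat}.
Local Notation mu := (leb R).
Local Notation I := (itv_oo t0 tf).
Local Notation model := (R -> 'cV[R]_nx -> 'cV[R]_ng).
Variables (x0 : 'cV[R]_nx) (f : R -> 'cV[R]_nx -> 'cV[R]_ng -> 'cV[R]_nx)
  (l : R -> 'cV[R]_nx -> 'cV[R]_ng -> R) (phi : 'cV[R]_nx -> R)
  (gc : model) (lambda : R -> 'cV[R]_nx) (Mf : R).
Hypothesis t0tf : t0 < tf.
Hypothesis mf : forall x g, measurable_vec t0 tf (fun t => f t x g).
Hypothesis cf : \forall t \ae mu, I t ->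
  continuous (fun p : 'cV[R]_nx * 'cV[R]_ng => f t p.1 p.2).
Hypothesis Mf0 : 0 <= Mf.
Hypothesis bf : \forall t \ae mu, I t -> forall x g, `|f t x g| <= Mf * (1 +
  `|g|).
Hypothesis Nf : cond_N t0 tf f.
Let pl t x g : 'cV[R]_1 := (l t x g)%:M.
Hypothesis Nl : cond_N t0 tf pl.
Hypothesis il : intg t0 tf (fun t => l t 0 0).
Hypothesis C1phi : C1 (fun x => (phi x)%:M : 'cV[R]_1).
Hypothesis Ggc : G2 t0 tf gc.
Let xc := state t0 tf f x0 gc.
Hypothesis adj : is_adjoint t0 tf f l gc xc phi lambda.

Let Nc := G2_norm t0 tf gc.
Let Nc0 : 0 <= Nc. Proof. exact: G2_norm_ge0. Qed.
Let Lc0 : 0 <= nx%:R * Nc. Proof. by rewrite mulr_ge0. Qed.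
(** One radius for all perturbations of norm at most 1: it bounds their states and the model values
    along them. *)
Let rho := state_radius t0 tf x0 Mf (Nc + 1) + Nc + 1.

Let xc_state : is_state t0 tf f x0 gc xc.
Proof. exact: (state_exists x0 t0tf mf cf Mf0 bf Nf Nc0 Lc0 (G2_tame Ggc)). Qed.

Let state_radius_le M : M <= Nc + 1 ->
  state_radius t0 tf x0 Mf M <= state_radius t0 tf x0 Mf (Nc + 1).
Proof.
move=> MN; rewrite /state_radius lerD2l ler_wpM2r ?subr_ge0 ?(ltW t0tf)//.
by rewrite ler_wpM2l// lerD2l.
Qed.

Let state_radius_ge0 : 0 <= state_radius t0 tf x0 Mf (Nc + 1).
Proof.
rewrite addr_ge0// mulr_ge0 ?subr_ge0 ?(ltW t0tf)// mulr_ge0//.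
by rewrite !addr_ge0.
Qed.

Let rho_gt0 : 0 < rho.
Proof. by rewrite /rho ltr_wpDl// addr_ge0. Qed.

Let radius_rho : state_radius t0 tf x0 Mf (Nc + 1) <= rho.
Proof. by rewrite /rho -addrA lerDl addr_ge0. Qed.

Let xc_ball t : t0 <= t <= tf -> `|xc t| <= rho.
Proof.
move=> tI; apply: le_trans radius_rho; apply: (@le_trans _ _ (state_radius t0
  tf x0 Mf Nc)).
  exact: (is_state_ball t0tf Mf0 bf Nc0 (G2_tame Ggc) xc_state).
by apply: state_radius_le; rewrite lerDl.
Qed.

Let xc_meas : measurable_vec t0 tf xc.
Proof. exact: measurable_vec_Linfty (is_state_vprimitive t0tf xc_state). Qed.

Let itvW t : I t -> t0 <= t <= tf.
Proof. by rewrite itv_ooE => /andP[/ltW-> /ltW->]. Qed.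

Lemma model_along_Linfty (d : model) j : G2 t0 tf d ->
  Linfty t0 tf (fun t => d t (xc t) j 0).
Proof.
move=> Gd; split.
  apply: measurable_along xc_meas j; first by case: Gd.
  by apply: filterS (G2_C2_bounded Gd) => t + /[dup] It =>
    /(_ It)[/C2_continuous].
exists (G2_norm t0 tf d); apply: filterS (G2_C2_bounded Gd) => t H /H[_ dN _ _].
exact: le_trans (mx_norm_entry _ _ _) (dN _).
Qed.

Let gc_meas : measurable_vec t0 tf (fun t => gc t (xc t)).
Proof. by move=> j; have [] := model_along_Linfty j Ggc. Qed.

Definition adjoint_weight t : 'cV[R]_ng :=
  (B_along f gc xc t)^T *m lambda t + gradg_along l gc xc t.

Let lambda_primitive : exists2 w, vprimitive t0 tf lambda w &
  \forall t \ae mu, I t -> - w t = (A_along f gc xc t)^T *m lambda t +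
    gradx_along l gc xc t + (jac (gc t) (xc t))^T *m gradg_along l gc xc t.
Proof.
have [[w lw wE] _] := adj.
by exists w; [exact: W1oo_vprimitive|exact: wE].
Qed.

Let lambda_Linfty i : Linfty t0 tf (fun t => lambda t i 0).
Proof. by have [w lw _] := lambda_primitive; exact: primitive_Linfty (lw i).
  Qed.

Let gc_ball : \forall t \ae mu, I t -> `|gc t (xc t)| <= rho.
Proof.
apply: filterS (G2_C2_bounded Ggc) => t H /H[_ gN _ _];
  apply: (le_trans (gN _)).
by rewrite /rho addrAC lerDr addr_ge0.
Qed.

Lemma adjoint_weight_Linfty j : Linfty t0 tf (fun t => adjoint_weight t j 0).
Proof.
have dN n (p : R -> 'cV[R]_nx -> 'cV[R]_ng -> 'cV[R]_n) : cond_N t0 tf p ->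
    \forall t \ae mu, I t -> (forall z y, differentiable (p t ^~ z) y) /\
      forall y z, differentiable (p t y) z.
  by move=> [_ H _ _]; apply: filterS H => t H /H[dx dg _ _]; split.
have mN n (p : R -> 'cV[R]_nx -> 'cV[R]_ng -> 'cV[R]_n) (Np :
  cond_N t0 tf p) i :
    measurable_fun I (fun t : lebR R => jacg (p t) (xc t) (gc t (xc t)) i j).
  apply: measurable_jacg_along (dN _ _ Np) xc_meas gc_meas.
  by case: Np.
have lN n (p : R -> 'cV[R]_nx -> 'cV[R]_ng -> 'cV[R]_n) (Np :
  cond_N t0 tf p) i :
    Linfty t0 tf (fun t => jacg (p t) (xc t) (gc t (xc t)) i j).
  split; first exact: mN.
  have [L [M [_ _ sm]]] := cond_N_smooth rho_gt0 Np; exists M.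
  apply: filterS2 sm gc_ball => t sm gb It; have [_ _ bM _] := sm It.
  apply: (le_trans (mx_norm_entry _ _ _)).
  exact: (bM _ _ (xc_ball (itvW It)) (gb It)).2.
have L1 : Linfty t0 tf (fun t => \sum_i jacg (f t) (xc t) (gc t (xc t)) i j *
  lambda t i 0).
  by apply: Linfty_sum => i; apply: LinftyM; [exact: lN|exact: lambda_Linfty].
apply: (Linfty_ae_eq (LinftyD L1 (lN _ _ Nl 0))); apply: aeW => t _;
  rewrite [RHS]mxE; congr (_ + _).
  by rewrite [RHS]mxE; apply: eq_bigr => i _; rewrite [in RHS]mxE.
by rewrite [RHS]mxE.
Qed.

Definition qoi_derivative (d : model) : R :=
  Int t0 tf (fun t => \sum_j adjoint_weight t j 0 * d t (xc t) j 0).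

Lemma weighted_model_Linfty (d : model) : G2 t0 tf d ->
  Linfty t0 tf (fun t => \sum_j adjoint_weight t j 0 * d t (xc t) j 0).
Proof.
move=> Gd; apply: Linfty_sum => j; apply: LinftyM.
  exact: adjoint_weight_Linfty.
exact: model_along_Linfty.
Qed.

Lemma qoi_derivative_linear a (d1 d2 : model) : G2 t0 tf d1 -> G2 t0 tf d2 ->
  qoi_derivative (a *: d1 + d2) = a * qoi_derivative d1 + qoi_derivative d2.
Proof.
move=> G1 G2; have L1 := weighted_model_Linfty G1; have L2 :=
  weighted_model_Linfty G2.
have La : Linfty t0 tf (a \*o fun t => \sum_j adjoint_weight t j 0 * d1 t (xc
  t) j 0).
  by apply: (@LinftyM _ _ _ (cst a)) => //; exact: Linfty_cst.
rewrite /qoi_derivative -IntZ; last exact: Linfty_intg.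
rewrite -IntD; [|exact: Linfty_intg..].
congr Int; apply/funext => t /=; rewrite mulr_sumr -big_split;
  apply: eq_bigr => j _.
by rewrite !mxE /=; ring.
Qed.

Lemma qoi_derivative_bounded : exists C : R, forall d : model, G2 t0 tf d ->
  `|qoi_derivative d| <= C * G2_norm t0 tf d.
Proof.
have [W W0 HW] := Linfty_vec_bound adjoint_weight_Linfty.
exists (ng%:R * W * (tf - t0)) => d Gd; rewrite mulrAC.
apply: Int_bound; [exact: ltW|exact: weighted_model_Linfty|].
apply: filterS2 HW (G2_C2_bounded Gd) => t HW Gb It.
have [_ dN _ _] := Gb It.
apply: (le_trans (dot_norm_le (adjoint_weight t) (d t (xc t)))).
apply: ler_pM; [exact: mulr_ge0|exact: normr_ge0| |exact: dN].
by apply: ler_wpM2l; [exact: ler0n|exact: HW].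
Qed.

(** In [t] the cost is merely integrable: it is dominated by [l t 0 0] in absolute value plus the
    variation of [l t] over the ball. *)
Lemma running_cost_intg (x : R -> 'cV[R]_nx) (g : R -> 'cV[R]_ng) :
  (forall t, t0 <= t <= tf -> `|x t| <= rho) ->
  (\forall t \ae mu, I t -> `|g t| <= rho) ->
  measurable_vec t0 tf x -> measurable_vec t0 tf g ->
  intg t0 tf (fun t => l t (x t) (g t)).
Proof.
move=> xr gr mx mg.
have [L [M [_ M0 sm]]] := cond_N_smooth rho_gt0 Nl.
have [ml regl _ _] := Nl.
pose K := (nx + ng)%:R * M * (rho + rho).
have iK : intg t0 tf (fun t => `|l t 0 0| + K).
  apply: (@intgD _ _ _ (fun t => `|l t 0 0|) (cst K));
    first exact: intg_norm il.
  exact/Linfty_intg/Linfty_cst.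
apply: (intg_dominated _ iK).
  apply: (@measurable_along2 _ _ _ _ _ l); [| |exact: mx|exact: mg].
    move=> y z; have := ml y z 0; apply: eq_measurable_fun => t _.
    by rewrite mxE eqxx mulr1n.
  have lE t : l t = fun y z => pl t y z 0 0.
    by apply/funext => y; apply/funext => z; rewrite mxE eqxx mulr1n.
  apply: filterS regl => t + It => /(_ It)[dx dg _ _]; rewrite lE;
    split => [z y|y z].
    apply: (@continuous_comp _ _ _ (pl t ^~ z) (fun A : 'cV[R]_1 => A 0 0));
      last exact: coord_continuous.
    exact: differentiable_continuous.
  apply: (@continuous_comp _ _ _ (pl t y) (fun A : 'cV[R]_1 => A 0 0));
    last exact: coord_continuous.
  exact: differentiable_continuous.
apply: filterS2 sm gr => t smt grt It.
have z0 k : `|0 : 'cV[R]_k| <= rho by rewrite normr0 ltW.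
have := smooth_lipschitz (smt It) (xr _ (itvW It)) (z0 _) (grt It) (z0 _).
rewrite !subr0 /pl -raddfB/= scalar_mx_norm => H.
have : (nx + ng)%:R * M * (`|x t| + `|g t|) <= K.
  rewrite ler_wpM2l ?mulr_ge0// lerD//; [exact: xr (itvW It)|exact: grt].
move=> /(le_trans H){}H.
rewrite -[in leLHS](subrK (l t 0 0) (l t _ _)) addrC.
by rewrite (le_trans (ler_normD _ _))// lerD2l.
Qed.

Let lambda_tf : lambda tf = grad phi (xc tf).
Proof. by have [_ ->] := adj. Qed.

(* Integrating (lambda . z)' over [t0, tf], where z is the state perturbation,
   turns the terminal cost into an integral. *)
Lemma adjoint_identity (x w : R -> 'cV[R]_nx) (wl : R -> 'cV[R]_nx) :
  vprimitive t0 tf x w -> vprimitive t0 tf lambda wl -> x t0 = 0 ->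
  Linfty t0 tf (fun t => \sum_i (wl t i 0 * x t i 0 + lambda t i 0 * w t i 0))
    /\
  \sum_i grad phi (xc tf) i 0 * x tf i 0 =
  Int t0 tf (fun t => \sum_i (wl t i 0 * x t i 0 + lambda t i 0 * w t i 0)).
Proof.
move=> xw lw xt0.
have [Lp E] := primitive_sum (fun i => primitiveM (ltW t0tf) (lw i) (xw i)).
split; first exact: Lp.
have := E t0 tf (lexx _) (ltW t0tf) (lexx _); rewrite /= => <-.
rewrite lambda_tf [X in _ - X]big1 ?subr0// => i _.
by rewrite xt0 mxE mulr0.
Qed.

Lemma qoi_remainder e : 0 < e -> exists2 r : R, 0 < r &
  forall d : model, G2 t0 tf d -> G2_norm t0 tf d <= r ->
    `|qoi t0 tf f l phi x0 (gc + d) - qoi t0 tf f l phi x0 gc - qoi_derivative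
      d|
      <= e * G2_norm t0 tf d.
Proof.
move=> e0.
have [L1 [M1 [L10 M10 sm1]]] := cond_N_smooth rho_gt0 Nf.
have [L2 [M2 [L20 M20 sm2]]] := cond_N_smooth rho_gt0 Nl.
have [Lam Lam0 HLam] := Linfty_vec_bound lambda_Linfty.
have [wl lw wlE] := lambda_primitive.
have T0 : 0 < tf - t0 by rewrite subr_gt0.
have [CS CS0 CSE] : exists2 CS, 0 <= CS & CS = 2 * ((nx + ng)%:R * M1 * (tf -
  t0)) *
    expR (2 * ((nx + ng)%:R * M1 * (1 + nx%:R * Nc)) * (tf - t0)).
  eexists; last reflexivity.
  apply: mulr_ge0; last exact: expR_ge0.
  apply: mulr_ge0; first exact: ler0n.
  apply: mulr_ge0; last exact: ltW T0.
  by apply: mulr_ge0; [exact: ler0n|].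
have K_ge0 L M : 0 <= L -> 0 <= M -> 0 <= expansion_const (nx := nx) (ng :=
  ng) L M Nc CS.
  move=> ? ?; have nNC : 0 <= nx%:R * Nc * CS by exact: mulr_ge0 Lc0 CS0.
  apply: addr_ge0; apply: mulr_ge0; [exact: mulr_ge0|exact: sqr_ge0|exact:
    mulr_ge0|].
  apply: addr_ge0; last exact: mulr_ge0.
  by apply: mulr_ge0; [exact: mulr_ge0|].
have [K1 K10 K1E] : exists2 K1, 0 <= K1 & K1 = expansion_const (nx :=
  nx) (ng := ng) L1 M1 Nc CS.
  by eexists; last reflexivity; exact: K_ge0.
have [K2 K20 K2E] : exists2 K2, 0 <= K2 & K2 = expansion_const (nx :=
  nx) (ng := ng) L2 M2 Nc CS.
  by eexists; last reflexivity; exact: K_ge0.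
(* The remainder of [l] enters as it is, that of [f] after pairing with [lambda]. *)
have [KE KE0 KEE] : exists2 KE, 0 <= KE & KE = K2 + nx%:R * Lam * K1.
  eexists; last reflexivity; apply: addr_ge0; first exact: K20.
  by apply: mulr_ge0; [exact: mulr_ge0|].
(* Half of [e] is spent on [phi]; the factor [CS] converts the terminal state difference into the
   norm of [d]. *)
have e1 : 0 < e / (2 * (CS + 1)) by rewrite divr_gt0// mulr_gt0// ltr_wpDl.
have [del del0 Hphi] := C1_remainder (xc tf) e1 C1phi.
(* In this order: all states stay in the ball [rho]; the terminal state difference is at most [del];
   the quadratic integral remainder is at most half of [e] times the norm of [d]. *)
pose r := Num.min 1 (Num.min (del / (CS + 1)) (e / (2 * (KE * (tf - t0) + 1)))).
have KT0 : 0 <= KE * (tf - t0) by rewrite mulr_ge0// ltW.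
exists r.
  by rewrite !lt_min ltr01 divr_gt0 ?divr_gt0 ?mulr_gt0// ltr_wpDl.
move=> d Gd; have := G2_C2_bounded Gd; have := G2_tame Gd;
  have := G2_norm_ge0 t0 tf d.
move: (G2_norm t0 tf d) => D D0 td Cd; rewrite !le_min =>
  /andP[D1 /andP[Ddel De]].
have NcD : Nc + D <= rho.
  by rewrite /rho; have := state_radius_ge0; lra.
have NcD0 : 0 <= Nc + D by exact: addr_ge0 Nc0 D0.
have tgd := tameD (G2_tame Ggc) td.
pose x := state t0 tf f x0 (gc + d).
have sx : is_state t0 tf f x0 (gc + d) x.
  apply: (state_exists x0 t0tf mf cf Mf0 bf Nf NcD0 _ tgd).
  by apply: addr_ge0; [exact: Lc0|exact: mulr_ge0].
have x_ball t : t0 <= t <= tf -> `|x t| <= rho.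
  move=> tI; apply: le_trans radius_rho.
  apply: (@le_trans _ _ (state_radius t0 tf x0 Mf (Nc + D))).
    exact: (is_state_ball t0tf Mf0 bf NcD0 tgd sx).
  by apply: state_radius_le; rewrite lerD2l.
have stab t : t0 <= t <= tf -> `|x t - xc t| <= CS * D.
  move=> tI; have -> : CS * D = 2 * ((nx + ng)%:R * M1 * D * (tf - t0)) *
    expR (2 * ((nx + ng)%:R * M1 * (1 + nx%:R * Nc)) * (tf - t0)) by rewrite
      CSE; ring.
  apply: (state_stability t0tf Nc0 Lc0 D0 M10 _ _ x_ball xc_ball NcD sm1 sx
    xc_state tI).
    apply: filterS (G2_C2_bounded Ggc) => s H /H{}H; split; first by case: H.
    by move=> y y'; exact: C2_bounded_lipschitz H.
  by apply: filterS Cd => s H /H[_ dN _ _]; exact: dN.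
have px := is_state_vprimitive t0tf sx; have pc := is_state_vprimitive t0tf
  xc_state.
have x_meas := measurable_vec_Linfty px.
have g_meas : measurable_vec t0 tf (fun t => (gc + d) t (x t)).
  apply: measurable_along x_meas; first by case: tgd.
  by case: tgd => _; apply: filterS => t H /H[].
have g_ball : \forall t \ae mu, I t -> `|(gc + d) t (x t)| <= rho.
  by case: tgd => _; apply: filterS => t H /H[_ bN _];
    exact: le_trans (bN _) NcD.
have i1 := running_cost_intg x_ball g_ball x_meas g_meas.
have i2 := running_cost_intg xc_ball gc_ball xc_meas gc_meas.
have pz := vprimitiveB px pc.
have z0 : x t0 - xc t0 = 0.
  by have [_ ->] := sx; have [_ ->] := xc_state; rewrite subrr.
have [Lp Eadj] := adjoint_identity pz lw z0.
have Lw := weighted_model_Linfty Gd.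
set pdot := (fun t => \sum_i _) in Lp Eadj.
set wdot := (fun t => \sum_j _) in Lw.
pose l1 t := l t (x t) ((gc + d) t (x t)).
pose l2 t := l t (xc t) (gc t (xc t)).
(* [pdot] is the derivative of [lambda . z] and integrates to the linear part of the terminal cost;
   [wdot] is the integrand of the proposed derivative. *)
pose E := (l1 \- l2) \+ (pdot \- wdot).
have iE1 : intg t0 tf (l1 \- l2) by exact: intgB.
have iE2 : intg t0 tf (pdot \- wdot) by exact/Linfty_intg/LinftyB.
have IE : Int t0 tf E = Int t0 tf l1 - Int t0 tf l2 + (Int t0 tf pdot - Int t0
  tf wdot).
  by rewrite IntD// IntB// IntB//; exact: Linfty_intg.
have -> : qoi t0 tf f l phi x0 (gc + d) - qoi t0 tf f l phi x0 gc -
  qoi_derivative d =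
    (phi (x tf) - phi (xc tf) - \sum_i grad phi (xc tf) i 0 * (x tf - xc tf) i
      0)
    + Int t0 tf E.
  rewrite IE Eadj (_ : Int t0 tf wdot = qoi_derivative d)//.
  have -> : qoi t0 tf f l phi x0 (gc + d) = phi (x tf) + Int t0 tf l1 by [].
  have -> : qoi t0 tf f l phi x0 gc = phi (xc tf) + Int t0 tf l2 by [].
  move: (phi _) (phi _) (Int t0 tf l1) (Int t0 tf l2) (Int t0 tf pdot)
    (qoi_derivative d).
  by move=> *; ring.
have tfI : t0 <= tf <= tf by rewrite lexx ltW.
have CSdel : CS * D <= del.
  move: Ddel; rewrite ler_pdivlMr ?ltr_wpDl// => /(le_trans _); apply.
  by rewrite mulrDr mulr1 mulrC lerDl.
have H1 : `|phi (x tf) - phi (xc tf) - \sum_i grad phi (xc tf) i 0 * (x tf - xc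
  tf) i 0|
    <= e / 2 * D.
  apply: (le_trans (Hphi _ (le_trans (stab _ tfI) CSdel))).
  apply: (le_trans (ler_wpM2l (ltW e1) (stab _ tfI))).
  rewrite mulrA ler_wpM2r// invfM mulrA mulrAC -mulrA ler_piMr ?divr_ge0 ?(ltW
    e0)//.
  by rewrite ler_pdivrMr ?ltr_wpDl// mul1r lerDl.
have H2 : `|Int t0 tf E| <= e / 2 * D.
  apply: (@le_trans _ _ (KE * D ^+ 2 * (tf - t0))).
    rewrite -Int_cst ?(ltW t0tf)//; apply: Int_norm_le; [exact: intgD| |].
      exact/Linfty_intg/Linfty_cst.
    have HG : \forall t \ae mu, I t -> C2_bounded Nc (gc t) /\ C2_bounded D (d
      t).
      by apply: filterS2 (G2_C2_bounded Ggc) Cd => t Hg Hd It; split;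
        [exact: Hg|exact: Hd].
    have HS : \forall t \ae mu, I t -> smooth_on_ball rho L1 M1 (f t) /\
        smooth_on_ball rho L2 M2 (pl t).
      by apply: filterS2 sm1 sm2 => t Hg Hd It; split; [exact: Hg|exact: Hd].
    have HL : \forall t \ae mu, I t -> `|lambda t| <= Lam /\
        - wl t = (A_along f gc xc t)^T *m lambda t +
          gradx_along l gc xc t + (jac (gc t) (xc t))^T *m gradg_along l gc xc
            t.
      by apply: filterS2 HLam wlE => t Hg Hd It; split; [exact: Hg|exact: Hd].
    apply: filterS3 HG HS HL => t HG HS HL It.
    have [Hg Hd] := HG It; have [S1 S2] := HS It; have [Lt Wt] := HL It.
    have tI := itvW It.
    have X1 := smooth_expansion L10 M10 S1 Hg Hd NcD (x_ball _ tI) (xc_ball tI)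
      (stab _ tI).
    have X2 := smooth_expansion L20 M20 S2 Hg Hd NcD (x_ball _ tI) (xc_ball tI)
      (stab _ tI).
    (* Rewrites [E t] as the expansion remainder of [l] plus [lambda] paired with that of [f]; each
       is quadratic in [D]. *)
    have := @adjoint_cancellation R nx ng (A_along f gc xc t) (B_along f gc xc
      t)
      (jacx (pl t) (xc t) (gc t (xc t))) (jacg (pl t) (xc t) (gc t (xc t)))
      (jac (gc t) (xc t)) (lambda t) (wl t) (x t - xc t)
      (f t (x t) ((gc + d) t (x t)) - f t (xc t) (gc t (xc t))) (d t (xc t))
        (l1 t - l2 t) Wt.
    rewrite -addrA => EE.
    rewrite -[LHS]/(E t) in EE; rewrite EE.
    rewrite (le_trans (ler_normD _ _))// KEE mulrDl lerD//.
      apply: le_trans (mx_norm_entry _ 0 0) _.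
      by rewrite raddfB K2E; exact: X2.
    apply: (le_trans (dot_norm_le _ _)); rewrite -[leRHS]mulrA ler_pM
      ?mulr_ge0//.
      by rewrite ler_wpM2l.
    by rewrite K1E; exact: X1.
  have -> : KE * D ^+ 2 * (tf - t0) = (KE * (tf - t0) * D) * D by ring.
  rewrite ler_wpM2r//; move: De; rewrite ler_pdivlMr ?mulr_gt0 ?ltr_wpDl//.
  move=> H; rewrite ler_pdivlMr//; apply: le_trans H.
  by rewrite [leLHS]mulrAC mulrC ler_wpM2l// mulrC ler_wpM2l// lerDl.
apply: le_trans (ler_normD _ _) (le_trans (lerD H1 H2) _).
by rewrite -mulrDl -splitr.
Qed.

Lemma qoi_derivative_frechet :
  is_frechet_derivative t0 tf (qoi t0 tf f l phi x0) gc qoi_derivative.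
Proof.
by split; [exact: qoi_derivative_linear|exact: qoi_derivative_bounded|
  exact: qoi_remainder].
Qed.

(** The left side is the integral of a bounded function, the right side may be infinite. The
    absolute value is taken inside, and the integrands are compared under the monotone integral of
    nonnegative functions. *)
Lemma qoi_derivative_le_V (gp gs : model) (c : 'I_ng -> R)
    (eps : R -> 'cV[R]_nx -> 'cV[R]_ng) :
  G2 t0 tf gs -> G2 t0 tf gp ->
  (forall t, I t -> forall x i, 0 <= eps t x i 0) ->
  (forall t, I t -> forall x i, `|gp t x i 0 - gs t x i 0| <= c i * eps t x i
    0) ->
  measurable_vec t0 tf (fun t => eps t (xc t)) ->
  (`|qoi_derivative (gp - gs)|%:E <= (\big[Num.max/0]_(i < ng) c i)%:E *
      V_QoI t0 tf f l gc xc lambda eps)%E.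
Proof.
move=> Gs Gp eps0 epsE meps; set cmax := \big[Num.max/0]_(i < ng) c i.
pose v t := \sum_j `|adjoint_weight t j 0| * eps t (xc t) j 0.
have -> : V_QoI t0 tf f l gc xc lambda eps = (\int[mu]_(t in I) (v t)%:E)%E.
  apply: eq_integral => t _; congr EFin; rewrite mxE; apply: eq_bigr => j _.
  by congr (_ * _); rewrite [LHS]mxE [LHS]mxE.
have v0 t : I t -> 0 <= v t.
  by move=> It; apply: sumr_ge0 => j _; apply: mulr_ge0;
    [exact: normr_ge0|exact: eps0].
have cmax0 : 0 <= cmax by rewrite /cmax; exact: bigmax_ge_id.
have mv : measurable_fun I (v : lebR R -> R).
  apply: measurable_sum => j; apply: measurable_funM; last exact: meps.
  apply: measurableT_comp; first exact: normr_measurable.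
  by have [] := adjoint_weight_Linfty j.
pose h t := \sum_j adjoint_weight t j 0 * (gp - gs) t (xc t) j 0.
have lh : Linfty t0 tf h.
  apply: (Linfty_ae_eq (LinftyB (weighted_model_Linfty Gp)
    (weighted_model_Linfty Gs))).
  apply: aeW => t _ /=; rewrite -sumrB; apply: eq_bigr => j _.
  by rewrite -mulrBr; congr (_ * _); rewrite [RHS]mxE [X in _ = _ + X]mxE.
have hv t : I t -> `|h t| <= cmax * v t.
  move=> It; rewrite /v mulr_sumr; apply: (le_trans (ler_norm_sum _ _ _)).
  apply: ler_sum => j _; rewrite normrM mulrCA; apply: ler_wpM2l;
    first exact: normr_ge0.
  have -> : (gp - gs) t (xc t) j 0 = gp t (xc t) j 0 - gs t (xc t) j 0.
    by rewrite [LHS]mxE [X in _ + X = _]mxE.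
  apply: (le_trans (epsE t It _ j)); apply: ler_wpM2r; first exact: eps0.
  exact: (le_bigmax _ c j).
have mI := measurable_itv_oo t0 tf.
have mh : measurable_fun I (EFin \o h : lebR R -> \bar R).
  by apply/measurable_EFinP; have [] := lh.
rewrite (@EFin_normr_Rintegral _ _ _ mu I h mI (Linfty_intg lh)).
apply: (le_trans (le_abse_integral mu mI mh)).
have v0' t : I t -> (0 <= (v t)%:E)%E by move=> It; rewrite lee_fin; exact: v0.
have mv' : measurable_fun I (fun t : lebR R => (v t)%:E) by
  exact/measurable_EFinP.
(* Scaling holds for infinite integrals too: for [cmax = 0] both sides are 0, in line with the
   convention for [0 * oo]. *)
rewrite -(@ge0_integralZl_EFin _ _ _ mu I mI _ v0' mv' _ cmax0).
apply: (@ge0_le_integral _ _ _ mu I mI).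
- by move=> t _; exact: abse_ge0.
- exact: measurableT_comp.
- by apply/measurable_EFinP; apply: measurable_funM;
  [exact: measurable_cst|exact: mv].
- by move=> t It; rewrite lee_fin; exact: hv.
Qed.

End derivative.

Theorem theorem5p5 (R : realType) (nx ng : nat) (t0 tf : R) (x0 : 'cV[R]_nx)
  (f : R -> 'cV[R]_nx -> 'cV[R]_ng -> 'cV[R]_nx)
  (l : R -> 'cV[R]_nx -> 'cV[R]_ng -> R)
  (phi : 'cV[R]_nx -> R)
  (gs gc gp : R -> 'cV[R]_nx -> 'cV[R]_ng)
  (c : 'I_ng -> R) (eps : R -> 'cV[R]_nx -> 'cV[R]_ng)
  (lambda : R -> 'cV[R]_nx) :
  t0 < tf ->
  (forall x g, measurable_vec t0 tf (fun t => f t x g)) ->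
  (\forall t \ae leb R, itv_oo t0 tf t ->
     continuous (fun p : 'cV[R]_nx * 'cV[R]_ng => f t p.1 p.2)) ->
  (exists2 m_f : R -> R, Linfty t0 tf m_f &
     \forall t \ae leb R, itv_oo t0 tf t ->
       forall x g, `|f t x g| <= m_f t * (1 + `|g|)) ->
  (exists2 l_f : R -> R,
     (leb R).-integrable (itv_oo t0 tf) (fun t => (l_f t)%:E) &
     \forall t \ae leb R, itv_oo t0 tf t ->
       forall x1 x2 g1 g2,
         `|f t x1 g1 - f t x2 g2| <= l_f t * (`|x1 - x2| + `|g1 - g2|)) ->
  cond_N t0 tf f ->
  cond_N t0 tf (fun t x g => (l t x g)%:M : 'cV[R]_1) ->
  (leb R).-integrable (itv_oo t0 tf) (fun t => (l t 0 0)%:E) ->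
  C1 (fun x => (phi x)%:M : 'cV[R]_1) ->
  G2 t0 tf gs -> G2 t0 tf gc -> G2 t0 tf gp ->
  (forall i, 0 <= c i) ->
  (forall t, itv_oo t0 tf t -> forall x i, 0 <= eps t x i 0) ->
  (forall t, itv_oo t0 tf t -> forall x i,
     `|gp t x i 0 - gs t x i 0| <= c i * eps t x i 0) ->
  let xc := state t0 tf f x0 gc in
  measurable_vec t0 tf (fun t => eps t (xc t)) ->
  is_adjoint t0 tf f l gc xc phi lambda ->
  exists Dq : (R -> 'cV[R]_nx -> 'cV[R]_ng) -> R,
    is_frechet_derivative t0 tf (qoi t0 tf f l phi x0) gc Dq /\
    (`|Dq (gp - gs)|%:E
       <= (\big[Num.max/0]_(i < ng) c i)%:E
            * V_QoI t0 tf f l gc xc lambda eps)%E.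
Proof.
move=> t0tf mf cf [m_f [_ [M mfM]] bf] _ Nf Nl il C1phi Gs Gc Gp _ eps0 epsE xc
  meps adj.
(* The essential bound of [m_f] turns the growth condition into one with a constant; the absolute
   value makes it nonnegative. *)
have bf' : \forall t \ae leb R, itv_oo t0 tf t ->
    forall x g, `|f t x g| <= `|M| * (1 + `|g|).
  apply: filterS2 bf mfM => t bft Mt It x g; apply: (le_trans (bft It x g)).
  apply: ler_wpM2r; first by rewrite addr_ge0.
  exact: le_trans (ler_norm _) (le_trans (Mt It) (ler_norm M)).
exists (qoi_derivative t0 tf x0 f l gc lambda); split.
  exact: (qoi_derivative_frechet t0tf mf cf (normr_ge0 M) bf' Nf Nl il C1phi Gc
    adj).
exact: (qoi_derivative_le_V t0tf mf cf (normr_ge0 M) bf' Nf Nl Gc adj Gs Gp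
  eps0 epsE meps).
Qed.
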